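(* Let $t\ge 2$ be an integer. Let $G$ be a $C_{2t+1}$-free graph with maximum degree $\Delta\ge 1$. Then $\omega(L(G)^t)\le |E(T_{t,\Delta})|$. Moreover, for each $t\in\{2,3,4,6\}$, equality can occur for infinitely many $\Delta$; that is, there are infinitely many $\Delta$ for which there exists a $C_{2t+1}$-free graph $G$ of maximum degree $\Delta$ with $\omega(L(G)^t)=|E(T_{t,\Delta})|$.
   Context: Graphs are finite and simple. A graph is $C_{2t+1}$-free if it contains no cycle of length $2t+1$ as a (not necessarily induced) subgraph. The line graph $L(G)$ of a graph $G$ has the edges of $G$ as its vertices, two distinct edges being adjacent if they share an endpoint. For a graph $H$, the $t$-th power $H^t$ is the graph on the vertex set of $H$ in which two distinct vertices are adjacent if and only if their distance in $H$ is at most $t$. $\omega(H)$ denotes the clique number of $H$. $T_{k,\Delta}$ denotes the tree rooted at a vertex $v$, of height $k$, whose leaves are exactly the vertices at distance $k$ from $v$ and all of whose non-leaf vertices (including $v$) have degree $\Delta$; thus $|E(T_{k,\Delta})|=\sum_{m=1}^{k}\Delta(\Delta-1)^{m-1}$. In the degenerate case $\Delta=1$, $|E(T_{k,1})|$ is understood as the value of this sum with $0^0=1$, namely $1$. *)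

(* Defs.v *)
From mathcomp Require Import all_boot.

Set Implicit Arguments.
Unset Strict Implicit.
Unset Printing Implicit Defensive.

Record sgraph : Type := SGraph {
  vertex :> finType;
  adj : rel vertex;
  adj_sym : symmetric adj;
  adj_irrefl : irreflexive adj }.

Definition neighbours (G : sgraph) (x : G) : {set G} := [set y | adj x y].

(* The value on the graph without vertices is 0. *)
Definition max_degree (G : sgraph) : nat := \max_(x : G) #|neighbours x|.

Definition edges (G : sgraph) : {set {set G}} :=
  [set [set p.1; p.2] | p : G * G & adj p.1 p.2].

(* [ucycle] asks for a closed walk without repeated vertices; this is a cycle
   subgraph as soon as its length is at least 3. *)
Definition cycle_free (n : nat) (G : sgraph) : Prop :=
  ~ exists c : seq G, size c = n /\ ucycle (@adj G) c.

Definition is_clique (G : sgraph) (K : {set G}) : bool :=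
  [forall x in K, forall y in K, (x != y) ==> adj x y].

Definition clique_number (G : sgraph) : nat :=
  \max_(K : {set G} | is_clique K) #|K|.

Section LineGraph.
Variable G : sgraph.

Definition edge_type : finType := {A : {set G} | A \in edges G}.

Definition line_adj : rel edge_type :=
  fun A B => (A != B) && [exists v, (v \in val A) && (v \in val B)].

Lemma line_adj_sym : symmetric line_adj.
Proof.
by move=> A B; rewrite /line_adj eq_sym; congr (_ && _); apply: eq_existsb => v;
  rewrite andbC.
Qed.

Lemma line_adj_irrefl : irreflexive line_adj.
Proof. by move=> A; rewrite /line_adj eqxx. Qed.

Definition line_graph : sgraph := SGraph line_adj_sym line_adj_irrefl.

End LineGraph.

Section Power.
Variable H : sgraph.

Definition walk (x y : H) (n : nat) : bool :=
  [exists p : n.-tuple H, path (@adj H) x p && (last x p == y)].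

Lemma walkP x y n :
  reflect (exists p : seq H, [/\ size p = n, path (@adj H) x p & last x p = y])
          (walk x y n).
Proof.
apply: (iffP existsP) => [[p /andP[xp /eqP yE]]|[p [szp xp yE]]].
  by exists p; rewrite size_tuple.
have szp' : size p == n by rewrite szp.
by exists (Tuple szp'); rewrite /= xp yE eqxx.
Qed.

Lemma connect_walk x y : connect (@adj H) x y -> exists n, walk x y n.
Proof.
by case/connectP=> p xp yE; exists (size p); apply/walkP; exists p.
Qed.

(* [None] stands for infinity. *)
Definition dist (x y : H) : option nat :=
  match @idP (connect (@adj H) x y) with
  | ReflectT xy => Some (ex_minn (connect_walk xy))
  | ReflectF _ => None
  end.

Definition dist_le (x y : H) (t : nat) : bool :=
  if dist x y is Some d then d <= t else false.

Lemma dist_leP x y t :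
  reflect (exists2 n, n <= t & walk x y n) (dist_le x y t).
Proof.
rewrite /dist_le /dist; case: {-}_ / idP => [xy|nxy].
  case: ex_minnP => d wd dmin; apply: (iffP idP) => [dt|[n nt wn]].
    by exists d.
  exact: leq_trans (dmin _ wn) nt.
apply: (iffP idP) => // -[n _ /walkP[p [_ xp yE]]]; case: nxy.
by apply/connectP; exists p.
Qed.

Lemma walk_sym x y n : walk x y n -> walk y x n.
Proof.
case/walkP=> p [szp xp <-]; apply/walkP; exists (rev (belast x p)); split.
- by rewrite size_rev size_belast.
- by rewrite rev_path (eq_path (e' := @adj H)) // => u v; rewrite adj_sym.
- by case: p {szp xp} => //= z p; rewrite rev_cons last_rcons.
Qed.

Definition power_adj (t : nat) : rel H :=
  fun x y => (x != y) && dist_le x y t.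

Lemma power_adj_sym t : symmetric (power_adj t).
Proof.
move=> x y; rewrite /power_adj eq_sym; congr (_ && _).
by apply/dist_leP/dist_leP=> -[n nt /walk_sym wn]; exists n.
Qed.

Lemma power_adj_irrefl t : irreflexive (power_adj t).
Proof. by move=> x; rewrite /power_adj eqxx. Qed.

Definition power_graph (t : nat) : sgraph :=
  SGraph (power_adj_sym t) (power_adj_irrefl t).

End Power.

(* The tree of height k whose non-leaf vertices all have degree D.  A vertex is
   encoded by the word of child choices leading to it from the root [::]: the
   root has the D children [:: a] with a < D, and a vertex w at distance m from
   the root, 0 < m < k, has the D - 1 children [rcons w a] with a < D - 1.
   For D = 1 and k > 0 the graph is a single edge. *)
Section RegularTree.
Variables k D : nat.

Definition tree_vertex : finType :=
  {w : k.-bseq 'I_D | all (fun a : 'I_D => a < D.-1) (behead w)}.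

Definition word (w : tree_vertex) : seq 'I_D := val w.

Definition is_child (u w : tree_vertex) : bool :=
  [exists a : 'I_D, word w == rcons (word u) a].

Definition tree_adj : rel tree_vertex :=
  fun u w => is_child u w || is_child w u.

Lemma tree_adj_sym : symmetric tree_adj.
Proof. by move=> u w; rewrite /tree_adj orbC. Qed.

Lemma tree_adj_irrefl : irreflexive tree_adj.
Proof.
move=> w; rewrite /tree_adj orbb; apply/negbTE/existsP => -[a /eqP].
by move/(congr1 size)/eqP; rewrite size_rcons ltn_eqF.
Qed.

Definition regular_tree : sgraph := SGraph tree_adj_sym tree_adj_irrefl.

Lemma card_edges_regular_tree :
  #|edges regular_tree| = \sum_(1 <= m < k.+1) D * (D - 1) ^ (m - 1).
Proof.
have parentP (w : tree_vertex) :
    {u : tree_vertex | word u = take (size (word w)).-1 (word w)}.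
  case: w => -[s szs] /= als.
  have szt : size (take (size s).-1 s) <= k.
    by rewrite size_take_min (leq_trans (geq_minr _ _)).
  have alt : all (fun a : 'I_D => a < D.-1) (behead (Bseq szt)).
    have -> : behead (take (size s).-1 s) = take (size s).-2 (behead s).
      by case: s {szs szt als} => // a [].
    by apply/allP => x /mem_take /(allP als).
  by exists (exist _ (Bseq szt) alt).
pose parent w := sval (parentP w).
have wordI : injective word by move=> u w uw; do 2!apply: val_inj.
have childE u w : is_child u w = (word w != [::]) && (u == parent w).
  apply/existsP/andP => [[a /eqP wE]|[w0 /eqP->]].
    split; first by rewrite wE; case: (word u).
    apply/eqP/wordI; rewrite /parent; case: (parentP w) => u' /= ->.
    by rewrite wE size_rcons -cats1 take_size_cat.
  rewrite /parent; case: (parentP w) => u' /= ->.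
  case/lastP: (word w) w0 => // s a _; exists a.
  by rewrite size_rcons -[in take _ _]cats1 take_size_cat.
have child_parent w : word w != [::] -> is_child (parent w) w.
  by move=> w0; rewrite childE w0 eqxx.
have sz_child u w : is_child u w -> size (word w) = (size (word u)).+1.
  by case/existsP => a /eqP->; rewrite size_rcons.
pose nonroot := [set w | word w != [::]].
have -> : edges regular_tree = [set [set w; parent w] | w in nonroot].
  apply/setP => A; apply/imsetP/imsetP => -[].
    case=> u w; rewrite inE /= /tree_adj => /orP[] c ->; move: (c); rewrite childE => /andP[w0 /eqP->].
      by exists w; rewrite ?inE // setUC.
    by exists u; rewrite ?inE.
  move=> w; rewrite inE => w0 ->; exists (w, parent w) => //.
  by rewrite inE /= /tree_adj child_parent ?orbT.
rewrite card_in_imset; last first.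
  move=> u w; rewrite !inE => u0 w0 E.
  have: u \in [set w; parent w] by rewrite -E set21.
  have: w \in [set u; parent u] by rewrite E set21.
  rewrite !inE => /orP[/eqP->//|/eqP wu] /orP[/eqP//|/eqP uw].
  have := sz_child _ _ (child_parent _ u0).
  have := sz_child _ _ (child_parent _ w0).
  by rewrite -wu -uw => -> /eqP; rewrite ltn_eqF.
have -> : #|nonroot| = \sum_(i < k) #|[set w | size (word w) == i.+1]|.
  rewrite -sum1_card big_mkcond /=.
  under [RHS]eq_bigr do rewrite -sum1_card big_mkcond /=.
  rewrite exchange_big /=; apply: eq_bigr => w _; rewrite inE.
  have: size (word w) <= k by apply: size_bseq.
  case E: (word w) => [|a s] /= sk.
    by rewrite big1 // => i _; rewrite inE E.
  rewrite (bigD1 (Ordinal sk)) //= inE E eqxx big1 // => i.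
  by rewrite inE E eqSS -val_eqE /= eq_sym => /negbTE->.
rewrite big_add1 big_mkord; apply: eq_bigr => -[m mk] _ /=.
rewrite !subn1 /=.
have gP (p : 'I_D * m.-tuple 'I_D.-1) : {w : tree_vertex |
    word w = p.1 :: map (widen_ord (leq_pred D)) p.2}.
  have sz : size (p.1 :: map (widen_ord (leq_pred D)) p.2) <= k.
    by rewrite /= size_map size_tuple.
  have al : all (fun a : 'I_D => a < D.-1) (behead (Bseq sz)).
    by rewrite /= all_map; apply/allP => x _ /=.
  by exists (exist _ (Bseq sz) al).
have -> : D * D.-1 ^ m = #|{: 'I_D * m.-tuple 'I_D.-1}|.
  by rewrite card_prod card_tuple !card_ord.
have gI : injective (fun p => sval (gP p)).
  move=> p q /(congr1 word); case: (gP p) (gP q) => [u /= ->] [w /= ->] [].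
  case: p q => [a s] [b r] /= -> /inj_map E; congr (_, _); apply/val_inj/E.
  by move=> x y /(congr1 val) /= /val_inj.
rewrite -(card_imset _ gI); apply: eq_card => w; rewrite inE.
apply/idP/imsetP => [|[p _ ->]]; last first.
  by case: (gP p) => u /= ->; rewrite /= size_map size_tuple.
case E: (word w) => [|a s] //=; rewrite eqSS => szs.
have als : all (fun a : 'I_D => a < D.-1) s.
  by have := valP w; rewrite /= -/(word w) E.
have szt : size (pmap (insub : _ -> option 'I_D.-1) (map val s)) == m.
  by rewrite size_pmap_sub count_map -(eqP szs) -all_count.
exists (a, Tuple szt) => //; apply: wordI.
case: (gP _) => u /= ->; rewrite E; congr (_ :: _).
apply: (inj_map val_inj); rewrite -map_comp.
rewrite (eq_map (g := val)) //.
rewrite (@pmap_filter _ _ _ val) => [|x]; last by apply: insubK.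
symmetry; apply/all_filterP; rewrite all_map.
apply/allP => x /(allP als) /= xD; by rewrite insubT.
Qed.

End RegularTree.

(* Main.v *)
Require Import Defs.
From mathcomp Require Import all_boot.
From mathcomp Require Import all_algebra finfield zify ring.

Set Implicit Arguments.
Unset Strict Implicit.
Unset Printing Implicit Defensive.

(* Upper bound. Let [E] be a clique and [v] a vertex of largest degree in [E],
   with [E]-neighbours [u_1, ..., u_d]. An edge [xy] of [E] with [x] and [y] at
   distance at least [t] from [v] has, for every [i], an endpoint at distance
   [t - 1] from [u_i]. If neither endpoint served all the [u_i], two geodesics
   [v u_i ... x] and [v u_j ... y] would be disjoint outside [v] and close up to
   a cycle of length [2t + 1]. So one endpoint, say [x], is the end of at least
   [d] geodesics from [v], at least as many as there are edges of [E] at [x].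
   Counting the other edges of [E] at their farther endpoint, [E] has no more
   edges than there are non-backtracking walks of length [1, ..., t] from [v].

   Sharpness. The incidence graph of a generalized [t]-gon of order [(q, q)] is
   bipartite and [(q + 1)]-regular, any two of its edges are within distance [t],
   and it has as many edges as the tree. For [t = 2] it is complete bipartite;
   for [t = 3], [4], [6] take the projective plane, the symplectic quadrangle and
   the split Cayley hexagon over a field of [q] elements. In the last one, points
   are the lines spanned by trace zero split octonions of norm zero, two points
   being collinear when their product is zero; if [x] is a point and [L] a line,
   [L] has a point [r] orthogonal to [x], and [x * r], when it is not zero, is a
   point collinear with both. *)

(** * Walks and levels *)

Section Walks.
Variable G : sgraph.
Implicit Types (a u x y : G) (k : nat).

Fixpoint walks k a x : nat :=
  if k is k'.+1 then \sum_(u | adj a u) walks k' u x else (a == x).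

Lemma walksS k a x : walks k.+1 a x = \sum_(u | adj a u) walks k u x.
Proof. by []. Qed.

Lemma walksSr k a x : walks k.+1 a x = \sum_(y | adj y x) walks k a y.
Proof.
elim: k a => [|k IHk] a.
  rewrite /= big_mkcond [RHS]big_mkcond /= (bigD1 x) //= eqxx big1 => [|u]; last first.
    by move/negbTE->; rewrite if_same.
  rewrite [RHS](bigD1 a) //= eqxx [in RHS]big1 // => u.
  by rewrite eq_sym => /negbTE->; rewrite if_same.
rewrite walksS; under eq_bigr do rewrite IHk.
by rewrite exchange_big.
Qed.

Lemma walks_gt0P k a x :
  reflect (exists p, [/\ size p = k, path (@adj G) a p & last a p = x])
          (0 < walks k a x).
Proof.
elim: k a => [|k IHk] a.
  rewrite /= lt0b; apply: (iffP eqP) => [<-|[p [/size0nil->]] //].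
  by exists [::].
rewrite walksS lt0n sum_nat_eq0 negb_forall.
apply: (iffP existsP) => [[u]|[[|u p] []] //= [szp] /andP[au up] xE].
  rewrite negb_imply -lt0n => /andP[au /IHk[p [szp up xE]]].
  by exists (u :: p); rewrite /= szp au.
by exists u; rewrite negb_imply au -lt0n; apply/IHk; exists p.
Qed.

End Walks.

Section Levels.
Variables (G : sgraph) (t : nat) (v : G).
Implicit Types (u x y : G) (k : nat).

(* The distance from [v], truncated at [t.+1]. *)
Definition level x := find (fun k => 0 < walks k v x) (iota 0 t.+1).

Lemma level_leS x : level x <= t.+1.
Proof. by rewrite -[t.+1](size_iota 0) find_size. Qed.

Lemma level_walks x : level x <= t -> 0 < walks (level x) v x.
Proof.
move=> lx; have lx' : level x < size (iota 0 t.+1) by rewrite size_iota.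
have hs : has (fun k => 0 < walks k v x) (iota 0 t.+1) by rewrite has_find.
by have := nth_find 0 hs; rewrite -/(level x) nth_iota.
Qed.

Lemma level_min k x : 0 < walks k v x -> level x <= k.
Proof.
move=> wk; rewrite leqNgt; apply/negP => lk.
have kt : k < t.+1 by apply: leq_trans lk (level_leS x).
by have := before_find 0 lk; rewrite nth_iota // add0n wk.
Qed.

Lemma level_root : level v = 0.
Proof. by apply/eqP; rewrite -leqn0; apply: level_min; rewrite /= eqxx. Qed.

Lemma level0 x : level x = 0 -> x = v.
Proof.
move=> lx; have := @level_walks x; rewrite lx => /(_ isT) /=.
by rewrite lt0b => /eqP.
Qed.

Lemma level_adj x y : adj x y -> level y <= (level x).+1.
Proof.
move=> xy; case: (leqP (level x) t) => [lx|lx]; last first.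
  by apply: leq_trans (level_leS y) _; apply: leqW.
apply: level_min; rewrite walksSr (bigD1 x) //=.
by rewrite ltn_addr // level_walks.
Qed.

Lemma level_pred k x :
  level x = k.+1 -> k < t -> exists2 y, adj y x & level y = k.
Proof.
move=> lx kt; have := @level_walks x; rewrite lx => /(_ kt).
rewrite walksSr lt0n sum_nat_eq0 negb_forall => /existsP[y].
rewrite negb_imply -lt0n => /andP[yx /level_min yk]; exists y => //.
by apply/eqP; rewrite eqn_leq yk -ltnS -lx level_adj.
Qed.

Lemma level_path p x : path (@adj G) x p -> level (last x p) <= level x + size p.
Proof.
elim: p x => [|y p IHp] x /=; first by rewrite addn0.
by case/andP=> /level_adj xy /IHp /leq_trans; apply; rewrite addnS -addSn leq_add2r.
Qed.

(** A walk of length [k] that ends at level [k] is a geodesic, so [width] counts geodesics from [v],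
    and [horizontal] counts their continuations by an edge inside level [k]. *)
Definition width k := \sum_(x | level x == k) walks k v x.

Definition horizontal k :=
  \sum_(x | level x == k) walks k v x * #|[set y | adj x y & level y == k]|.

Lemma walks_above k x : k < level x -> walks k v x = 0.
Proof.
by rewrite ltnNge => /negP lx; apply/eqP; rewrite -leqn0 leqNgt; apply/negP => /level_min.
Qed.

(** A geodesic of length [k.+1] is one of length [k] followed by a step up; steps up and steps
    sideways lead to disjoint sets of neighbours. *)
Lemma width_rec k : k < t -> width k.+1 + horizontal k <=
  \sum_(x | level x == k) walks k v x * #|[set y | adj x y & k <= level y]|.
Proof.
move=> kt.
have -> : width k.+1 =
    \sum_(x | level x == k) walks k v x * #|[set y | adj x y & level y == k.+1]|.
  have -> : width k.+1 = \sum_(y | level y == k.+1)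
      \sum_(x | level x == k) walks k v x * adj x y.
    apply: eq_bigr => y /eqP ly; rewrite walksSr.
    rewrite big_mkcond [RHS]big_mkcond /=; apply: eq_bigr => x _.
    case: (altP (level x =P k)) => [_|lx].
      by case: ifP; rewrite ?muln1 ?muln0.
    case: ifP => // /level_adj; rewrite ly ltnS => kx.
    by rewrite walks_above // ltn_neqAle eq_sym lx.
  rewrite exchange_big /=; apply: eq_bigr => x _.
  rewrite -big_distrr /= -sum1_card; congr (_ * _).
  rewrite big_mkcond [RHS]big_mkcond /=; apply: eq_bigr => y _.
  by rewrite inE; case: (level y == _) (adj x y) => [] [].
rewrite -big_split /=; apply: leq_sum => x _; rewrite -mulnDr leq_mul2l.
apply/orP; right; rewrite -cardsUI.
rewrite [X in _ + #|pred_of_set X|](_ : _ = set0) ?cards0 ?addn0; last first.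
  apply/setP => y; rewrite !inE; apply/negP => /andP[/andP[_ /eqP->] /andP[_]].
  by rewrite eqn_leq ltnn.
apply/subset_leq_card/subsetP => y; rewrite !inE -andb_orr => /andP[-> /=].
by case/orP=> /eqP->.
Qed.

Variables (Delta : nat) (degG : forall x, #|neighbours x| <= Delta).

Lemma width1 : 0 < t -> width 1 <= Delta.
Proof.
move=> t0; apply: leq_trans (leq_addr (horizontal 0) _) _.
apply: leq_trans (width_rec t0) _.
rewrite (bigD1 v) ?level_root //= eqxx mul1n big1 ?addn0 => [|x /andP[/eqP/level0->]].
  by apply: leq_trans (degG v); apply/subset_leq_card/subsetP => y; rewrite !inE => /andP[].
by rewrite eqxx.
Qed.

(** A vertex on a positive level has a neighbour one level below, which leaves at most [Delta - 1]
    neighbours for steps up or sideways. *)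
Lemma width_succ k : 0 < k < t -> width k.+1 + horizontal k <= width k * (Delta - 1).
Proof.
case/andP=> k0 kt; apply: leq_trans (width_rec kt) _.
rewrite big_distrl /=; apply: leq_sum => x /eqP lx.
rewrite leq_mul2l; apply/orP; right.
case: k => // k in k0 kt lx *.
have [z zx lz] := level_pred lx (ltnW kt).
rewrite subn1 -ltnS; case: (posnP Delta) => [D0|D0].
  by move: (degG x); rewrite D0 leqn0 => /eqP/cards0_eq/setP/(_ z); rewrite !inE adj_sym zx.
rewrite prednK //; apply: leq_trans (degG x); apply/proper_card/properP; split.
  by apply/subsetP => y; rewrite !inE => /andP[].
by exists z; rewrite !inE adj_sym zx // lz ltnn.
Qed.

(** [horizontal k] is paid for together with [width k.+1], so its sum stops one level earlier. With
    [m.+1 = t], edges inside level [t] are not paid for; [far_edge] handles them. *)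
Lemma sum_width m : m < t ->
  \sum_(1 <= k < m.+2) width k + \sum_(1 <= k < m.+1) horizontal k
    <= \sum_(1 <= k < m.+2) Delta * (Delta - 1) ^ (k - 1).
Proof.
move=> mt.
have wk k : k < t -> width k.+1 <= Delta * (Delta - 1) ^ k.
  elim: k => [|k IHk] kt; first by rewrite muln1 width1.
  have := @width_succ k.+1; rewrite kt => /(_ isT) h.
  apply: leq_trans (leq_trans (leq_addr _ _) h) _.
  by rewrite expnSr mulnA leq_mul2r IHk ?orbT // ltnW.
elim: m mt => [|m IHm] mt.
  by rewrite !big_nat1 big_geq // addn0 muln1 width1.
rewrite big_nat_recr //= [X in _ + X]big_nat_recr //= [leqRHS]big_nat_recr //=.
rewrite addnACA leq_add ?IHm // ?(ltnW mt) //.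
apply: leq_trans (width_succ _) _; first by rewrite /= mt.
by rewrite (_ : m.+2 - 1 = m.+1) // expnSr mulnA leq_mul2r wk ?orbT // ltnW.
Qed.

End Levels.

(** * Distances in the line graph *)

Section LineGraphDistance.
Variable G : sgraph.
Implicit Types (a b x y : G) (e f : edge_type G).

Lemma edgeP (A : {set G}) :
  reflect (exists x y, adj x y /\ A = [set x; y]) (A \in edges G).
Proof.
apply: (iffP imsetP) => [[[x y] /= xy ->]|[x [y [xy ->]]]].
  by exists x, y; rewrite inE in xy.
by exists (x, y); rewrite ?inE.
Qed.

Lemma edge_adj e x y : x \in val e -> y \in val e -> x != y -> adj x y.
Proof.
case/edgeP: (valP e) => a [b [ab ->]]; rewrite !inE.
by case/orP=> /eqP-> /orP[] /eqP->; rewrite ?eqxx // adj_sym.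
Qed.

(** Consecutive edges share a vertex, and two successive shared vertices coincide or are the two
    ends of an edge of the path. They form a path of [G] once repetitions are dropped. *)
Lemma line_path_endpoints e (s : seq (line_graph G)) :
    path (@adj (line_graph G)) e s -> 0 < size s ->
  exists x p, [/\ x \in val e, path (@adj G) x p,
    last x p \in val (last (e : line_graph G) s) & size p < size s].
Proof.
elim: s e => // e1 [|e2 s] IHs e /=.
  by case/andP=> /andP[_ /existsP[c /andP[ce ce1]]] _ _; exists c, [::].
case/andP=> /andP[_ /existsP[c /andP[ce ce1]]] es _.
have [x [p [xe1 xp lp sp]]] := IHs e1 es isT.
case: (eqVneq c x) xp lp xe1 => [<-|cx] xp lp xe1; first by exists c, p; split=> //; apply: leqW.
by exists c, (x :: p); split=> //=; rewrite (edge_adj ce1 xe1).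
Qed.

Lemma dist_le_refl (H : sgraph) (x : H) t : dist_le x x t.
Proof. by apply/dist_leP; exists 0 => //; apply/walkP; exists [::]. Qed.

Lemma dist_le_trans (H : sgraph) (y x z : H) m n :
  dist_le x y m -> dist_le y z n -> dist_le x z (m + n).
Proof.
case/dist_leP=> i im /walkP[p [szp xp yE]] /dist_leP[j jn /walkP[q [szq yq zE]]].
apply/dist_leP; exists (i + j); first exact: leq_add.
apply/walkP; exists (p ++ q); rewrite size_cat szp szq cat_path last_cat xp.
by rewrite yE yq.
Qed.

Lemma dist_le_leq (H : sgraph) (x y : H) m n :
  m <= n -> dist_le x y m -> dist_le x y n.
Proof. by move=> mn /dist_leP[i im w]; apply/dist_leP; exists i => //; apply: leq_trans mn. Qed.

Lemma line_dist_common e f x : x \in val e -> x \in val f ->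
  dist_le (e : line_graph G) f 1.
Proof.
move=> xe xf; have [->|ef] := eqVneq e f; first exact: dist_le_refl.
apply/dist_leP; exists 1 => //; apply/walkP; exists [:: f]; split=> //=.
by rewrite andbT /line_adj ef; apply/existsP; exists x; rewrite xe.
Qed.

Lemma line_dist_path e f x p : x \in val e -> path (@adj G) x p ->
  last x p \in val f -> dist_le (e : line_graph G) f (size p).+1.
Proof.
elim: p e x => [|y p IHp] e x xe /= => [_|/andP[xy yp]] xf.
  exact: line_dist_common xf.
have Ae : [set x; y] \in edges G by apply/edgeP; exists x, y.
pose e1 : edge_type G := exist (fun A => A \in edges G) [set x; y] Ae.
rewrite -add1n; apply: (@dist_le_trans (line_graph G) e1); first by apply: line_dist_common xe _; rewrite set21.
by apply: IHp yp xf; rewrite set22.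
Qed.

End LineGraphDistance.

(** * Geodesics of length [t] and the odd cycle *)

Section Geodesics.
Variables (G : sgraph) (t : nat) (v : G).
Implicit Types (x y u w : G) (p q : seq G).
Local Notation lev := (level t v).

(** The level grows by at most 1 per step, so reaching level [t] in [t] steps from level 0 leaves no
    slack. *)
Lemma geodesic_levels p : path (@adj G) v p -> size p = t ->
  t <= lev (last v p) -> map lev (v :: p) = iota 0 t.+1.
Proof.
move=> vp szp lt; apply: (@eq_from_nth _ 0); rewrite size_map ?size_iota ?[size (_ :: _)]/= ?szp // => i it.
rewrite (nth_map v) ?[size (_ :: _)]/= ?szp // nth_iota //.
have -> : nth v (v :: p) i = last v (take i p).
  by rewrite (last_nth v) size_takel ?szp //; case: i it => //= i it; rewrite nth_take.
have := vp; rewrite -{1}(cat_take_drop i p) cat_path => /andP[/level_path l1 /level_path l2].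
have := l2 t v; have := l1 t v; rewrite level_root size_drop szp size_takel ?szp //.
rewrite -last_cat cat_take_drop => h1 h2; apply/eqP; rewrite eqn_leq h1 add0n.
by have := leq_trans lt h2; lia.
Qed.

Lemma geodesic_nth p1 w p2 : path (@adj G) v (p1 ++ w :: p2) ->
  size (p1 ++ w :: p2) = t -> t <= lev (last v (p1 ++ w :: p2)) ->
  lev w = (size p1).+1.
Proof.
move=> vp szp /(geodesic_levels vp szp) /(congr1 (fun s => nth 0 s (size p1).+1)).
have lt : size p1 < t by rewrite -szp size_cat /=; lia.
by rewrite /= map_cat nth_cat size_map ltnn subnn nth_iota.
Qed.

Lemma common_endpoint (U : {set G}) x y :
    0 < t -> cycle_free (2 * t + 1) G -> adj x y -> t <= lev x -> t <= lev y ->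
    (forall u, u \in U -> adj v u) ->
    (forall u, u \in U -> 0 < walks t.-1 u x \/ 0 < walks t.-1 u y) ->
  (forall u, u \in U -> 0 < walks t.-1 u x) \/
  (forall u, u \in U -> 0 < walks t.-1 u y).
Proof.
move=> t0 cfG xy ltx lty vU Uxy.
case: (boolP [forall u in U, 0 < walks t.-1 u x]) => [/forall_inP|]; first by left.
case/forall_inPn => j jU jx; right => i iU.
rewrite lt0n; apply/negP => /eqP iy.
have {}jx : walks t.-1 j x = 0 by apply/eqP; rewrite -leqn0 leqNgt.
have jy : 0 < walks t.-1 j y by case: (Uxy j jU) => //; rewrite jx.
have ix : 0 < walks t.-1 i x by case: (Uxy i iU) => //; rewrite iy.
case/walks_gt0P: jy => q [szq jq ly]; case/walks_gt0P: ix => p [szp ip lx].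
have vp : path (@adj G) v (i :: p) by rewrite /= vU.
have vq : path (@adj G) v (j :: q) by rewrite /= vU.
have szp' : size (i :: p) = t by rewrite /= szp prednK.
have szq' : size (j :: q) = t by rewrite /= szq prednK.
have lvp : t <= lev (last v (i :: p)) by rewrite /= lx.
have lvq : t <= lev (last v (j :: q)) by rewrite /= ly.
have [up uq] : uniq (v :: i :: p) /\ uniq (v :: j :: q).
  by split; apply: (@map_uniq _ _ lev); rewrite geodesic_levels // iota_uniq.
(* The cycle runs from [v] through [i] to [x], crosses the edge to [y] and returns through [j]. *)
case: cfG; exists (v :: (i :: p) ++ rev (j :: q)); split.
  by rewrite /= size_cat size_rev /= szp szq; lia.
apply/andP; split.
  rewrite -[cycle _ _]/(path (@adj G) v (rcons ((i :: p) ++ rev (j :: q)) v)).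
  rewrite rcons_cat cat_path vp -rev_cons.
  rewrite (lastI v (j :: q)) rev_rcons [last v _]/= [last v _]/= lx ly.
  rewrite [path _ x _]/= xy /= -{1}ly.
  rewrite (rev_path _ v (j :: q)) (eq_path (e' := @adj G)) // => a b.
  by rewrite adj_sym.
case/andP: up => /negbTE vNp up; case/andP: uq => /negbTE vNq uq.
rewrite cons_uniq cat_uniq rev_uniq mem_cat mem_rev vNp vNq [uniq _]up [uniq _]uq /=.
rewrite andbT; apply/hasPn => w; rewrite mem_rev => wq; apply/negP => wp.
(* A common vertex [w] has the same position in both geodesics, given by its level. Following the
   one through [j] up to [w] and the one through [i] afterwards leads from [j] to [x] in [t.-1]
   steps. *)
have [p1 [p2 Ep]] : exists p1 p2, i :: p = p1 ++ w :: p2.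
  by case/splitPr: wp => p1 p2; exists p1, p2.
have [q1 [q2 Eq]] : exists q1 q2, j :: q = q1 ++ w :: q2.
  by case/splitPr: wq => q1 q2; exists q1, q2.
have lp1 : lev w = (size p1).+1 by apply: (@geodesic_nth p1 w p2); rewrite -Ep.
have lq1 : lev w = (size q1).+1 by apply: (@geodesic_nth q1 w q2); rewrite -Eq.
have [r Er] : exists r, q1 ++ w :: p2 = j :: r.
  by case: (q1) Eq => [|? q'] [-> _] /=; [exists p2 | exists (q' ++ w :: p2)].
suff: 0 < walks t.-1 j x by rewrite jx.
apply/walks_gt0P; exists r; split.
- have E : size p1 = size q1 by move: lq1; rewrite lp1 => -[].
  have := congr1 size Er; rewrite size_cat -E -size_cat -Ep /= szp.
  by case.
- have := vp; rewrite Ep cat_path /= => /and3P[_ _ wp2].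
  have := vq; rewrite Eq cat_path /= => /and3P[vq1 q1w _].
  have : path (@adj G) v (q1 ++ w :: p2) by rewrite cat_path /= vq1 q1w wp2.
  by rewrite Er => /andP[].
- have := congr1 (last v) Er; rewrite last_cat /= => <-.
  by rewrite -lx; have := congr1 (last v) Ep; rewrite last_cat /= => <-.
Qed.

End Geodesics.

(** * The upper bound *)

Lemma pair_edge_adj (G : sgraph) (x y : G) : [set x; y] \in edges G -> adj x y.
Proof.
case/edgeP=> a [b [ab E]].
have ba : (b == a) = false by apply/eqP => h; rewrite h adj_irrefl in ab.
have : a \in [set x; y] by rewrite E set21.
have : b \in [set x; y] by rewrite E set22.
rewrite !inE => /orP[] /eqP Eb /orP[] /eqP Ea; move: ab ba; rewrite Ea Eb ?eqxx //.
by rewrite adj_sym.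
Qed.

Lemma edge_partner (G : sgraph) (A : {set G}) x :
  A \in edges G -> x \in A -> exists2 y, adj x y & A = [set x; y].
Proof.
case/edgeP=> a [b [ab ->]]; rewrite !inE => /orP[] /eqP->; first by exists b.
by exists a; rewrite 1?adj_sym 1?setUC.
Qed.

Section UpperBound.
Variables (G : sgraph) (t Delta : nat) (E : {set {set G}}).
Hypothesis t_gt0 : 0 < t.
Hypothesis G_free : cycle_free (2 * t + 1) G.
Hypothesis degG : forall x : G, #|neighbours x| <= Delta.
Hypothesis E_edges : E \subset edges G.
Hypothesis E_close : forall A B, A \in E -> B \in E -> A != B ->
  exists x p, [/\ x \in A, path (@adj G) x p, last x p \in B & size p < t].

Let deg x := #|[set A in E | x \in A]|.

Lemma sum_delta_nat m n (l : nat) (F : nat -> nat) :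
  \sum_(m <= k < n) (if l == k then F k else 0) = if m <= l < n then F l else 0.
Proof.
rewrite -big_mkcond; under eq_bigl do rewrite eq_sym.
exact: big_nat1_eq.
Qed.

Lemma card_edges_at (F : {set {set G}}) x (Y : {set G}) :
  (forall A, A \in F -> exists2 y, y \in Y & A = [set x; y]) -> #|F| <= #|Y|.
Proof.
move=> FY; apply: leq_trans (leq_imset_card (fun y => [set x; y]) Y).
by apply/subset_leq_card/subsetP => A /FY[y yY ->]; apply: imset_f.
Qed.

(** Each neighbour on level [k] is the end of at least one geodesic, which extends to [x]. *)
Lemma card_level_pred (v : G) k x : level t v x = k.+1 -> k < t ->
  #|[set y | adj x y & level t v y == k]| <= walks k.+1 v x.
Proof.
move=> lx kt; rewrite walksSr -sum1_card big_mkcond [leqRHS]big_mkcond /=.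
apply: leq_sum => y _; rewrite inE adj_sym; case: ifP => // /andP[-> /eqP ly].
by rewrite -ly level_walks // ly ltnW.
Qed.

Section MaxDegreeVertex.
Variable v : G.
Hypothesis v_max : forall x, deg x <= deg v.
Hypothesis v_gt0 : 0 < deg v.
Local Notation lev := (level t v).

Let U := [set u | [set v; u] \in E].

Lemma deg_root : deg v <= #|U|.
Proof.
apply: (@card_edges_at _ v) => A; rewrite inE => /andP[AE vA].
have [y vy Ay] := edge_partner (subsetP E_edges _ AE) vA.
by exists y; rewrite // inE -Ay.
Qed.

Lemma far_edge a b : adj a b -> [set a; b] \in E -> t <= lev a -> t <= lev b ->
  exists x, [/\ x \in [set a; b], lev x = t & #|U| <= walks t v x].
Proof.
move=> ab abE lta ltb.
have ltab x : x \in [set a; b] -> t <= lev x by rewrite !inE => /orP[] /eqP->.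
have vU u : u \in U -> adj v u.
  by rewrite inE => uE; apply: pair_edge_adj (subsetP E_edges _ uE).
have Uab u : u \in U -> 0 < walks t.-1 u a \/ 0 < walks t.-1 u b.
  move=> uU; have vu := vU u uU; move: uU; rewrite inE => uE.
  have neq : [set v; u] != [set a; b].
    apply/eqP => h; have := ltab v; rewrite -h set21 level_root => /(_ isT).
    by rewrite leqNgt t_gt0.
  have [z [p [zvu zp lp szp]]] := E_close uE abE neq.
  have ltp := ltab _ lp; have lzp := level_path t v zp.
  (* A path starting at [v] would be too short to reach level [t]. So it starts at [u], and its
     length is exactly [t.-1]. *)
  move: zvu; rewrite !inE => /orP[] /eqP zE; move: zE zp lp ltp lzp => -> zp lp ltp lzp.
    by move: lzp; rewrite level_root add0n leqNgt (leq_trans szp ltp).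
  have lu := level_adj t v vu; rewrite level_root in lu.
  have sz : size p = t.-1.
    apply/eqP; rewrite eqn_leq -ltnS prednK // szp -ltnS prednK //.
    by apply: leq_trans ltp (leq_trans lzp _); rewrite -add1n leq_add2r.
  move: lp; rewrite !inE => /orP[] /eqP <-; [left | right];
  by apply/walks_gt0P; exists p.
have good x : x \in [set a; b] -> (forall u, u \in U -> 0 < walks t.-1 u x) ->
    lev x = t /\ #|U| <= walks t v x.
  move=> xab Ux; have Uw : #|U| <= walks t v x.
    rewrite -(prednK t_gt0) walksS -sum1_card big_mkcond [leqRHS]big_mkcond /=.
    by apply: leq_sum => u _; case: ifP => // uU; rewrite vU // Ux.
  split=> //; apply/eqP; rewrite eqn_leq ltab // andbT level_min //.
  exact: leq_trans v_gt0 (leq_trans deg_root Uw).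
have [Ux|Ux] := common_endpoint t_gt0 G_free ab lta ltb vU Uab.
  by have [] := good a (set21 a b) Ux; exists a; rewrite set21.
by have [] := good b (set22 a b) Ux; exists b; rewrite set22.
Qed.

(* An edge is counted at an endpoint of largest level, except that an edge with
   both endpoints at level at least [t] is counted at the endpoint provided by
   [far_edge]. *)
Definition chargeable (A : {set G}) x := (x \in A) &&
  ((lev x < t) && [forall y in A, lev y <= lev x] ||
   (lev x == t) && ([forall y in A, (y != x) ==> (lev y < t)] ||
     (#|U| <= walks t v x))).

Lemma chargeable_exists A : A \in E -> exists x, chargeable A x.
Proof.
move=> AE; have [a [b [ab EA]]] := edgeP _ (subsetP E_edges _ AE).
wlog lba : a b ab EA / lev b <= lev a.
  move=> h; case/orP: (leq_total (lev b) (lev a)) => l; first exact: (h a b).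
  by apply: (h b a); rewrite 1?adj_sym // setUC.
rewrite {}EA in AE *; have [ltb|ltb] := leqP t (lev b).
  have [x [xab lx Ux]] := far_edge ab AE (leq_trans ltb lba) ltb.
  by exists x; rewrite /chargeable xab lx eqxx Ux !orbT.
exists a; rewrite /chargeable set21 /=.
have := level_adj t v (etrans (adj_sym b a) ab) => /leq_trans/(_ ltb).
rewrite leq_eqVlt => /orP[/eqP E1|lat].
  rewrite E1 eqxx ltnn /=; apply/orP; left; apply/forall_inP => y.
  by rewrite !inE => /orP[] /eqP->; rewrite ?eqxx // ltb implybT.
rewrite lat /=; apply/orP; left; apply/forall_inP => y.
by rewrite !inE => /orP[] /eqP->.
Qed.

Lemma card_chargeable x : #|[set A in E | chargeable A x]| <=
  \sum_(1 <= k < t.+1) (if lev x == k then walks k v x else 0) +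
  \sum_(1 <= k < t) (if lev x == k then
     walks k v x * #|[set y | adj x y & lev y == k]| else 0).
Proof.
rewrite !sum_delta_nat; case: (posnP (lev x)) => [lx|lx].
  (* Nothing is charged to [v]: the other end of an edge at [v] has a larger level. *)
  rewrite [X in X <= _]eq_card0 // => A; rewrite !inE; apply/negP.
  case/andP=> AE /andP[xA]; have [y xy EA] := edge_partner (subsetP E_edges _ AE) xA.
  rewrite lx t_gt0 (ltn_eqF t_gt0) orbF /= => /forall_inP/(_ y).
  rewrite EA set22 => /(_ isT); rewrite leqn0 => /eqP/level0 yv.
  by move: xy; rewrite yv (level0 lx) adj_irrefl.
rewrite ltnS; case: (ltngtP (lev x) t) => [lt|lt|lt].
- have wx := level_walks (ltnW lt).
  case lk: (lev x) lx lt wx => [//|k] _ lt wx /=.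
  pose Y1 := [set y | adj x y & lev y == k].
  pose Y2 := [set y | adj x y & lev y == k.+1].
  (* The other end of an edge charged to [x] is one level below or on the same level. The former are
     at most as many as the geodesics to [x]; the latter are covered by the horizontal term. *)
  apply: (@leq_trans #|Y1 :|: Y2|).
    apply: (@card_edges_at _ x) => A; rewrite inE => /andP[AE /andP[xA]].
    rewrite lk lt (ltn_eqF lt) orbF /= => /forall_inP h.
    have [y xy EA] := edge_partner (subsetP E_edges _ AE) xA.
    exists y => //; rewrite !inE xy /=.
    have := h y; rewrite EA set22 => /(_ isT).
    have := level_adj t v (etrans (adj_sym y x) xy).
    by rewrite lk; lia.
  apply: leq_trans (leq_card_setU _ _) _; apply: leq_add.
    by apply: card_level_pred; rewrite // ltnW.
  by rewrite leq_pmull.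
- rewrite (_ : [set _ in _ | _] = set0) ?cards0 //; apply/setP => A; rewrite !inE.
  by rewrite /chargeable (gtn_eqF lt) ltnNge (ltnW lt) /= !andbF.
rewrite /= addn0.
(* If at least [#|U|] geodesics end at [x], they outnumber all edges of [E] at [x], by the choice of
   [v]. Otherwise only edges going down are charged to [x]. *)
case: (leqP #|U| (walks t v x)) => [Ux|Ux].
  rewrite lt; apply: leq_trans Ux; apply: leq_trans deg_root.
  apply: leq_trans (v_max x); apply/subset_leq_card/subsetP => A.
  by rewrite !inE => /andP[-> /andP[->]].
have lt' : lev x = t.-1.+1 by rewrite prednK.
rewrite {1}lt'; apply: leq_trans (card_level_pred lt' _); last by rewrite prednK.
apply: (@card_edges_at _ x) => A; rewrite inE => /andP[AE /andP[xA]].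
rewrite lt ltnn eqxx (leqNgt #|U|) Ux orbF /= => /forall_inP h.
have [y xy EA] := edge_partner (subsetP E_edges _ AE) xA.
exists y => //; rewrite inE xy /=.
have yx : y != x by apply/eqP => yx; rewrite yx adj_irrefl in xy.
have := h y; rewrite EA set22 yx => /(_ isT) /= lyt.
have := level_adj t v (etrans (adj_sym y x) xy).
by rewrite lt; lia.
Qed.

Lemma card_close_edges_max :
  #|E| <= \sum_(1 <= k < t.+1) Delta * (Delta - 1) ^ (k - 1).
Proof.
have := @sum_width G t v Delta degG t.-1; rewrite !prednK // => /(_ (leqnn _)).
apply: leq_trans.
pose c A := odflt v [pick x | chargeable A x].
have cP A : A \in E -> chargeable A (c A).
  by move=> AE; rewrite /c; case: pickP => // h; case: (chargeable_exists AE) => x; rewrite h.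
apply: (@leq_trans (\sum_x #|[set A in E | chargeable A x]|)).
  rewrite -sum1_card (partition_big c xpredT) //=; apply: leq_sum => x _.
  rewrite -sum1_card big_mkcond [leqRHS]big_mkcond /=; apply: leq_sum => A _.
  by rewrite inE; case: (boolP (A \in E)) => //= AE; case: eqP => // <-; rewrite cP.
apply: leq_trans; first by apply: leq_sum => x _; apply: card_chargeable.
rewrite big_split /= leq_add //.
  by rewrite exchange_big /= leq_sum // => k _; rewrite /width [leqRHS]big_mkcond.
by rewrite exchange_big /= leq_sum // => k _; rewrite /horizontal [leqRHS]big_mkcond.
Qed.

End MaxDegreeVertex.

Lemma card_close_edges : #|E| <= \sum_(1 <= k < t.+1) Delta * (Delta - 1) ^ (k - 1).
Proof.
have [->|[A AE]] := set_0Vmem E; first by rewrite cards0.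
have [a [b [_ EA]]] := edgeP _ (subsetP E_edges _ AE).
case: (@arg_maxnP _ a xpredT deg isT) => v _ v_max.
apply: (@card_close_edges_max v) => [x|]; first exact: v_max.
apply: leq_trans (v_max a isT); apply/card_gt0P; exists A.
by rewrite inE AE EA set21.
Qed.

End UpperBound.

Lemma clique_number_leq (G : sgraph) (t : nat) : 0 < t -> cycle_free (2 * t + 1) G ->
  clique_number (power_graph (line_graph G) t) <=
    #|edges (regular_tree t (max_degree G))|.
Proof.
move=> t0 cfG; apply/bigmax_leqP => K /forall_inP Kcl.
rewrite card_edges_regular_tree -(card_imset _ val_inj).
apply: card_close_edges => // [x||A B].
- exact: (leq_bigmax x).
- by apply/subsetP => _ /imsetP[e _ ->]; apply: valP.
case/imsetP=> e eK -> /imsetP[f fK ->] /negbTE ef.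
have {}ef : e != f by apply/eqP => h; rewrite h eqxx in ef.
have /forall_inP/(_ f fK) := Kcl e eK.
rewrite ef /= => /andP[_ /dist_leP[n nt /walkP[s [szs es lf]]]].
have s0 : 0 < size s.
  by rewrite lt0n; apply: contraNneq ef => /size0nil s0; rewrite s0 /= in lf; rewrite lf.
have [x [p [xe xp lp szp]]] := line_path_endpoints es s0.
by exists x, p; split=> //; [rewrite -lf | rewrite (leq_trans szp) // szs].
Qed.

(** * Incidence graphs of linear spaces of singular vectors *)

Lemma bipartite_odd_cycle_free (G : sgraph) (c : G -> bool) (n : nat) :
  (forall x y, adj x y -> c y = ~~ c x) -> odd n -> cycle_free n G.
Proof.
move=> cG n_odd [[|x p] [sz /andP[xp _]]]; first by rewrite -sz in n_odd.
have col (s : seq G) y : path (@adj G) y s -> c (last y s) = c y (+) odd (size s).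
  elim: s y => [|z s IHs] y /=; first by rewrite addbF.
  by case/andP=> /cG yz /IHs->; rewrite yz addbN addNb.
by have := col _ _ xp; rewrite last_rcons size_rcons -sz in n_odd *; rewrite n_odd; case: (c x).
Qed.

Lemma clique_number_geq (G : sgraph) (t : nat) :
    (forall A B, A \in edges G -> B \in edges G ->
       exists x p, [/\ x \in A, path (@adj G) x p, last x p \in B & size p < t]) ->
  #|edges G| <= clique_number (power_graph (line_graph G) t).
Proof.
move=> close; rewrite -[#|edges G|]card_sig.
apply: (@bigmax_sup _ [set: power_graph (line_graph G) t]); last by rewrite cardsT.
apply/forall_inP => e _; apply/forall_inP => f _; apply/implyP => ef.
rewrite /= /power_adj ef /=.
have [x [p [xe xp pf szp]]] := close _ _ (valP e) (valP f).
exact: dist_le_leq szp (line_dist_path xe xp pf).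
Qed.

Lemma card_fibers (T T' : finType) (f : T -> T') (A : {set T}) (k : nat) :
  (forall x, x \in A -> #|[set y in A | f y == f x]| = k) -> #|A| = #|f @: A| * k.
Proof.
move=> fk; rewrite -sum1_card (partition_big_imset f) /= -sum_nat_const.
apply: eq_bigr => _ /imsetP[x xA ->]; rewrite -(fk x xA) -sum1_card.
by apply: eq_bigl => y; rewrite inE.
Qed.

Section Geometry.
Variables (F : finFieldType) (V : finLmodType F) (P : {set V}) (R : rel V).
Local Notation q := #|F|.

Import GRing.Theory.
Local Open Scope ring_scope.

Implicit Types (x y z u w : V) (a b : F) (A L : {set V}).

Definition point x : {set V} := [set a *: x | a : F].
Definition line x y : {set V} := [set c.1 *: x + c.2 *: y | c : F * F].

Lemma pointP x y : reflect (exists a, y = a *: x) (y \in point x).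
Proof. by apply: (iffP imsetP) => [[a _ ->]|[a ->]]; exists a. Qed.

Lemma lineP x y z : reflect (exists a b, z = a *: x + b *: y) (z \in line x y).
Proof.
apply: (iffP imsetP) => [[[a b] _ ->]|[a [b ->]]]; first by exists a, b.
by exists (a, b).
Qed.

Lemma mem_point x : x \in point x.
Proof. by apply/pointP; exists 1; rewrite scale1r. Qed.

Lemma zero_point x : 0 \in point x.
Proof. by apply/pointP; exists 0; rewrite scale0r. Qed.

Lemma mem_linel x y : x \in line x y.
Proof. by apply/lineP; exists 1, 0; rewrite scale1r scale0r addr0. Qed.

Lemma mem_liner x y : y \in line x y.
Proof. by apply/lineP; exists 0, 1; rewrite scale1r scale0r add0r. Qed.

Lemma line_comb x y z w a b :
  z \in line x y -> w \in line x y -> a *: z + b *: w \in line x y.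
Proof.
move=> /lineP[c [d ->]] /lineP[c' [d' ->]]; apply/lineP.
exists (a * c + b * c'), (a * d + b * d').
by rewrite !scalerDr !scalerA !scalerDl addrACA.
Qed.

Lemma point_sub_line x y z : z \in line x y -> point z \subset line x y.
Proof.
move=> zL; apply/subsetP => _ /pointP[a ->].
by have := line_comb a 0 zL zL; rewrite scale0r addr0.
Qed.

Lemma card_point x : x != 0 -> #|point x| = q.
Proof.
move=> x0; rewrite card_imset // => a b /eqP.
by rewrite -subr_eq0 -scalerBl scaler_eq0 (negbTE x0) orbF subr_eq0 => /eqP.
Qed.

Lemma card_line x y : x != 0 -> y \notin point x -> #|line x y| = (q ^ 2)%N.
Proof.
move=> x0 yx; rewrite card_imset ?card_prod ?mulnn // => -[a b] [c d] /= E.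
have {}E : (b - d) *: y = (c - a) *: x.
  apply/eqP; rewrite !scalerBl subr_eq addrAC eq_sym subr_eq addrC.
  by rewrite [X in _ == X]addrC E addrC.
have bd : b = d.
  apply/eqP; rewrite -subr_eq0; apply: contraR yx => bd.
  by apply/pointP; exists ((b - d)^-1 * (c - a)); rewrite -scalerA -E scalerK.
move/eqP: E; rewrite bd subrr scale0r eq_sym scaler_eq0 (negbTE x0) orbF.
by rewrite subr_eq0 => /eqP->.
Qed.

Lemma eq_point x y : x != 0 -> y != 0 -> y \in point x -> point y = point x.
Proof.
move=> x0 y0 /pointP[a yE]; apply/eqP; rewrite eqEcard !card_point // leqnn andbT.
by apply/subsetP => _ /pointP[b ->]; apply/pointP; exists (b * a); rewrite yE scalerA.
Qed.

Lemma eq_line x y z w : x != 0 -> y \notin point x -> z != 0 -> w \notin point z ->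
  z \in line x y -> w \in line x y -> line z w = line x y.
Proof.
move=> x0 yx z0 wz zL wL; apply/eqP; rewrite eqEcard !card_line // leqnn andbT.
by apply/subsetP => _ /lineP[a [b ->]]; apply: line_comb.
Qed.

(** In the applications [P] consists of all nonzero vectors, or of those of norm zero, and [R] is
    collinearity. The vectors related to a given one are closed under linear combinations, so any
    two vectors of a line are related. *)
Hypothesis P0 : 0 \notin P.
Hypothesis R_sym : symmetric R.
Hypothesis R_refl : forall x, x \in P -> R x x.
Hypothesis R_lin : forall x y z a b, R x y -> R x z -> R x (a *: y + b *: z).
Hypothesis R_P : forall x y, x \in P -> R x y -> y != 0 -> y \in P.

Definition points := point @: P.
Definition lines := [set line p.1 p.2 |
  p in [set p : V * V | [&& p.1 \in P, R p.1 p.2 & p.2 \notin point p.1]]].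

Lemma P_neq0 x : x \in P -> x != 0.
Proof. by move=> xP; apply: contraNneq P0 => <-. Qed.

Lemma linesP L : reflect (exists x y, [/\ x \in P, R x y, y \notin point x & L = line x y])
  (L \in lines).
Proof.
apply: (iffP imsetP) => [[[x y] /[!inE] /and3P[xP xy yx] ->]|]; first by exists x, y.
by case=> x [y [xP xy yx ->]]; exists (x, y); rewrite // inE /= xP xy.
Qed.

Lemma line_singular L : L \in lines ->
  (forall z, z \in L -> z != 0 -> z \in P) /\ (forall z w, z \in L -> w \in L -> R z w).
Proof.
case/linesP=> x [y [xP xy yx ->]].
have y0 : y != 0 by apply: contraNneq yx => ->; apply: zero_point.
have yP := R_P xP xy y0.
have Rx z : z \in line x y -> R x z.
  by case/lineP=> a [b ->]; apply: R_lin => //; apply: R_refl.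
have Ry z : z \in line x y -> R y z.
  by case/lineP=> a [b ->]; apply: R_lin; [rewrite R_sym | apply: R_refl].
split=> [z zL|z w zL]; first by apply: R_P xP (Rx z zL).
by case/lineP=> a [b ->]; apply: R_lin; rewrite R_sym ?Rx ?Ry.
Qed.

Lemma line_spanned L z w : L \in lines -> z \in L -> w \in L -> z != 0 ->
  w \notin point z -> L = line z w.
Proof.
case/linesP=> x [y [xP xy yx ->]] zL wL z0 wz.
by rewrite (eq_line _ _ _ _ zL wL) // P_neq0.
Qed.

Lemma card_of_line L : L \in lines -> #|L| = (q ^ 2)%N.
Proof. by case/linesP=> x [y [xP _ yx ->]]; rewrite card_line // P_neq0. Qed.

Lemma card_of_point A : A \in points -> #|A| = q.
Proof. by case/imsetP=> x xP ->; rewrite card_point // P_neq0. Qed.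

(** The sizes [q] and [q ^ 2] differ. Points and lines are vertices of the same type, so this is
    what makes the graph bipartite. *)
Lemma point_not_line A : A \in points -> A \notin lines.
Proof.
move/card_of_point => cA; apply/negP => /card_of_line; rewrite cA => /eqP.
have := finNzRing_gt1 F; rewrite -mulnn => q1.
by rewrite -{1}[q]muln1 eqn_pmul2l ?(ltnW q1) // eqn_leq (leqNgt _ 1) q1 andbF.
Qed.

Definition incident A L := [&& A \in points, L \in lines & A \subset L].

Definition geometry_adj : rel {set V} := fun A B => incident A B || incident B A.

Lemma geometry_adj_sym : symmetric geometry_adj.
Proof. by move=> A B; rewrite /geometry_adj orbC. Qed.

Lemma geometry_adj_irrefl : irreflexive geometry_adj.
Proof.
move=> A; rewrite /geometry_adj orbb /incident.
by case: (boolP (A \in points)) => //= /point_not_line/negbTE->.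
Qed.

(* The subsets of [V] that are neither points nor lines are isolated vertices. *)
Definition geometry_graph := SGraph geometry_adj_sym geometry_adj_irrefl.

Lemma points_on_line L : L \in lines -> #|[set A in points | A \subset L]| = q.+1.
Proof.
move=> Ll; have q1 := finNzRing_gt1 F.
have [LP _] := line_singular Ll.
have -> : [set A in points | A \subset L] = point @: (L :\ 0).
  apply/setP => A; rewrite inE; apply/andP/imsetP => [[/imsetP[x xP ->] /subsetP xL]|].
    by exists x; rewrite // !inE P_neq0 // xL // mem_point.
  case=> x; rewrite !inE => /andP[x0 xL] ->; split; first by rewrite imset_f // LP.
  by case/linesP: Ll xL => u [w [_ _ _ ->]] /point_sub_line.
have zL : 0 \in L.
  case/linesP: Ll => u [w [_ _ _ ->]]; apply/lineP; exists 0, 0.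
  by rewrite !scale0r addr0.
(* The [q ^ 2 - 1] nonzero vectors of [L] are shared out among its points, [q - 1] to each. *)
have : #|L :\ 0| = (#|point @: (L :\ 0%R)| * q.-1)%N.
  apply: card_fibers => x; rewrite !inE => /andP[x0 xL].
  rewrite (_ : [set _ in _ | _] = point x :\ 0).
    by have := cardsD1 0 (point x); rewrite zero_point card_point // => ->.
  apply/setP => y; rewrite !inE; apply/andP/andP => [[/andP[y0 yL] /eqP <-]|[y0 yx]].
    by rewrite mem_point.
  split; last by apply/eqP/eq_point => //; apply: P_neq0.
  rewrite y0; case/linesP: Ll xL => u [w [_ _ _ ->]] /point_sub_line/subsetP; exact.
have := cardsD1 0 L; rewrite zL (card_of_line Ll) => /(congr1 predn) /=; rewrite add0n => <-.
rewrite -subn1 -(exp1n 2) subn_sqr subn1 addn1 mulnC => /eqP.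
by rewrite eqn_pmul2r ?ltn_predRL // => /eqP.
Qed.

Hypothesis card_R : forall x, x \in P -> #|[set y | R x y]| = (q ^ 3)%N.

(** The [q ^ 3 - q] vectors related to [x] and outside its point are partitioned by the lines
    through that point, [q ^ 2 - q] to each. *)
Lemma lines_on_point A : A \in points -> #|[set L in lines | A \subset L]| = q.+1.
Proof.
case/imsetP=> x xP ->; have q1 := finNzRing_gt1 F; have x0 := P_neq0 xP.
set S := [set y | R x y] :\: point x.
have -> : [set L in lines | point x \subset L] = (line x) @: S.
  apply/setP => L; rewrite inE; apply/andP/imsetP => [[Ll /subsetP xL]|].
    have {}xL := xL x (mem_point x).
    have [_ LR] := line_singular Ll.
    have /subsetPn[y yL yx] : ~~ (L \subset point x).
      apply/negP => /subset_leq_card; rewrite card_point // card_of_line // -mulnn.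
      by rewrite -{3}[q]muln1 leq_pmul2l ?(ltnW q1) // leqNgt q1.
    by exists y; [rewrite !inE yx LR | apply: line_spanned].
  case=> y /[!inE] /andP[yx xy] ->; split; last first.
    exact/point_sub_line/mem_linel.
  by apply/linesP; exists x, y.
have : #|S| = (#|[set line x y | y in S]| * (q ^ 2 - q))%N.
  apply: card_fibers => y; rewrite !inE => /andP[yx xy].
  rewrite (_ : [set _ in _ | _] = line x y :\: point x).
    rewrite cardsD card_line // (setIidPr _) ?card_point //.
    exact/point_sub_line/mem_linel.
  have Ll : line x y \in lines by apply/linesP; exists x, y.
  apply/setP => z; rewrite !inE; apply/andP/andP => [[/andP[zx xz] /eqP <-]|[zx zL]].
    by rewrite zx mem_liner.
  have [_ LR] := line_singular Ll.
  rewrite zx LR ?mem_linel //; split=> //.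
  by rewrite eq_sym; apply/eqP/line_spanned => //; apply: mem_linel.
rewrite cardsD card_R // (setIidPr _) ?card_point //; last first.
  apply/subsetP => _ /pointP[a ->]; rewrite inE.
  by have := R_lin a 0 (R_refl xP) (R_refl xP); rewrite scale0r addr0.
have -> : (q ^ 3 - q = q.+1 * (q ^ 2 - q))%N.
  by rewrite mulnBr !mulSn mulnn -expnS [(q + _)%N]addnC subnDl.
move/eqP; rewrite eqn_pmul2r; first by move/eqP.
by rewrite subn_gt0 -mulnn -{1}[q]muln1 ltn_pmul2l // ltnW.
Qed.

Lemma collinear_path x y : x \in P -> R x y -> y != 0 ->
  exists p, [/\ path geometry_adj (point x) p, last (point x) p = point y & (size p <= 2)%N].
Proof.
move=> xP xy y0; case: (boolP (y \in point x)) => [yx|yx].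
  by exists [::]; rewrite /= (eq_point (P_neq0 xP) y0 yx).
have Ll : line x y \in lines by apply/linesP; exists x, y.
have inc z : z \in P -> z \in line x y -> incident (point z) (line x y).
  by move=> zP zL; rewrite /incident imset_f // Ll point_sub_line.
exists [:: line x y; point y]; rewrite /= /geometry_adj.
by rewrite inc ?mem_linel // (inc y) ?mem_liner ?orbT // (R_P xP xy y0).
Qed.

Variable t : nat.
Hypothesis t_gt0 : (0 < t)%N.
Hypothesis card_P : #|P| = (q ^ t - 1)%N.
Hypothesis connected : forall A L B M, incident A L -> incident B M ->
  exists C p, [/\ C \in [set A; L], path geometry_adj C p,
    last C p \in [set B; M] & (size p < t)%N].

Lemma card_points : #|points| = (\sum_(i < t) q ^ i)%N.
Proof.
have q1 := finNzRing_gt1 F.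
have : #|P| = (#|point @: P| * q.-1)%N.
  apply: card_fibers => x xP; have x0 := P_neq0 xP.
  rewrite (_ : [set _ in _ | _] = point x :\ 0).
    by have := cardsD1 0 (point x); rewrite zero_point card_point // => ->.
  apply/setP => y; rewrite !inE; apply/andP/andP => [[yP /eqP <-]|[y0 yx]].
    by rewrite mem_point P_neq0.
  split; last by apply/eqP/eq_point => //; apply: P_neq0.
  case/pointP: yx y0 => a -> y0; apply: (R_P xP _ y0).
  by have := R_lin a 0 (R_refl xP) (R_refl xP); rewrite scale0r addr0.
rewrite card_P subn1 predn_exp mulnC => /eqP.
by rewrite eqn_pmul2r ?ltn_predRL // => /eqP.
Qed.

Lemma geometry_max_degree : max_degree geometry_graph = q.+1.
Proof.
have nP A : A \in points -> neighbours (A : geometry_graph) = [set L in lines | A \subset L].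
  move=> Ap; apply/setP => L; rewrite !inE /= /geometry_adj /incident Ap.
  by rewrite (negbTE (point_not_line Ap)) andbF orbF.
apply/eqP; rewrite eqn_leq; apply/andP; split.
  apply/bigmax_leqP => A _; case: (boolP (A \in points)) => [Ap|Ap].
    by rewrite nP ?lines_on_point.
  case: (boolP (A \in lines)) => [Al|Al].
    rewrite -(points_on_line Al); apply/subset_leq_card/subsetP => B.
    by rewrite !inE /= /geometry_adj /incident (negbTE Ap) Al.
  rewrite [X in (X <= _)%N](_ : _ = 0)%N //; apply: eq_card0 => B.
  by rewrite !inE /= /geometry_adj /incident (negbTE Ap) (negbTE Al) andbF.
have /card_gt0P[A Ap] : (0 < #|points|)%N.
  rewrite card_points; case: (t) t_gt0 => // n _.
  by rewrite big_ord_recl expn0.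
by rewrite -(lines_on_point Ap) -nP //; apply: (leq_bigmax (A : geometry_graph)).
Qed.

Lemma geometry_cycle_free n : odd n -> cycle_free n geometry_graph.
Proof.
have pl A L : incident A L -> A \in points /\ L \notin points.
  by case/and3P=> Ap Ll _; split=> //; apply: contraTN Ll; apply: point_not_line.
apply: (@bipartite_odd_cycle_free geometry_graph (mem points)) => A B.
rewrite -[mem points A]/(A \in points) -[mem points B]/(B \in points).
by case/orP=> /pl[-> /negbTE->].
Qed.

(** Edges correspond to flags, and each of the [\sum_(i < t) q ^ i] points is on [q.+1] lines; the
    product is the sum for the tree with [Delta = q.+1]. *)
Lemma geometry_card_edges :
  (#|edges (regular_tree t q.+1)| <= #|edges geometry_graph|)%N.
Proof.
rewrite card_edges_regular_tree subSS subn0 big_add1 big_mkord /=.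
under eq_bigr do rewrite subSS subn0.
rewrite -big_distrr /= -card_points mulnC.
pose flags := [set p : {set V} * {set V} | incident p.1 p.2].
apply: (@leq_trans #|flags|).
  rewrite -sum_nat_const -[#|flags|]sum1_card.
  rewrite (partition_big (fun p => p.1) (mem points)) /= => [|p]; last first.
    by rewrite inE => /and3P[].
  apply: leq_sum => A Ap; rewrite -(lines_on_point Ap) -sum1_card.
  rewrite -(big_imset (h := fun L => (A, L)) (fun=> 1%N)) /=; last by move=> L M _ _ [].
  rewrite big_mkcond [leqRHS]big_mkcond /=; apply: leq_sum => p _.
  case: ifP => // /imsetP[L]; rewrite inE => /andP[Ll AL] ->.
  by rewrite inE /= /incident Ap Ll AL eqxx.
have inj : {in flags &, injective (fun p => [set p.1; p.2])}.
  move=> [A L] [B M]; rewrite !inE /= => /and3P[Ap Ll _] /and3P[Bp Ml _] E.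
  have pl C D : C \in points -> D \in lines -> (C == D) = false.
    by move=> Cp Dl; apply/eqP => h; move: (point_not_line Cp); rewrite h Dl.
  have : A \in [set B; M] by rewrite -E set21.
  have : L \in [set B; M] by rewrite -E set22.
  by rewrite !inE (pl A M) // eq_sym (pl B L) //= orbF => /eqP-> /eqP->.
rewrite -(card_in_imset inj); apply/subset_leq_card/subsetP => _ /imsetP[[A L] + ->].
by rewrite inE /= => AL; apply/(@edgeP geometry_graph); exists A, L; rewrite /= /geometry_adj AL.
Qed.

Lemma geometry_clique_number :
  (#|edges (regular_tree t q.+1)| <=
    clique_number (power_graph (line_graph geometry_graph) t))%N.
Proof.
apply: leq_trans geometry_card_edges _; apply: clique_number_geq => X Y.
have flag Z : Z \in edges geometry_graph ->
    exists A L, incident A L /\ Z = [set A; L].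
  case/edgeP=> A [L [/= /orP[AL|LA] ->]]; first by exists A, L.
  by exists L, A; rewrite setUC.
case/flag=> A [L [AL ->]] /flag[B [M [BM ->]]]; exact: connected.
Qed.

Lemma geometry_extremal : exists G : sgraph,
  [/\ cycle_free (2 * t + 1) G, max_degree G = q.+1 &
      clique_number (power_graph (line_graph G) t) = #|edges (regular_tree t q.+1)|].
Proof.
have cf : cycle_free (2 * t + 1) geometry_graph.
  by apply: geometry_cycle_free; rewrite addn1 /= oddM.
exists geometry_graph; split=> //; first exact: geometry_max_degree.
apply/eqP; rewrite eqn_leq geometry_clique_number andbT.
by rewrite -geometry_max_degree clique_number_leq.
Qed.

End Geometry.

(** * Generalized polygons *)

Section CompleteBipartite.
Variable n : nat.

Definition bipartite_adj : rel (bool * 'I_n) := fun x y => x.1 != y.1.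

Lemma bipartite_adj_sym : symmetric bipartite_adj.
Proof. by move=> x y; rewrite /bipartite_adj eq_sym. Qed.

Lemma bipartite_adj_irrefl : irreflexive bipartite_adj.
Proof. by move=> x; rewrite /bipartite_adj eqxx. Qed.

Definition complete_bipartite := SGraph bipartite_adj_sym bipartite_adj_irrefl.

Lemma complete_bipartite_neighbours (x : complete_bipartite) : #|neighbours x| = n.
Proof.
have -> : neighbours x = [set (~~ x.1, i) | i : 'I_n].
  apply/setP => -[b i]; rewrite inE; apply/idP/imsetP => [|[j _ [-> _]]].
    by rewrite /= /bipartite_adj /= => xb; exists i => //; case: b (x.1) xb => [] [].
  by rewrite /= /bipartite_adj /=; case: (x.1).
by rewrite card_imset ?card_ord // => i j [].
Qed.

(** There are [n + n * (n - 1)] edges, and one edge joins the left end of any edge to the right end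
    of any other. *)
Lemma complete_bipartite_extremal : 0 < n -> exists G : sgraph,
  [/\ cycle_free (2 * 2 + 1) G, max_degree G = n &
      clique_number (power_graph (line_graph G) 2) = #|edges (regular_tree 2 n)|].
Proof.
move=> n_gt0.
have cf : cycle_free (2 * 2 + 1) complete_bipartite.
  apply: (@bipartite_odd_cycle_free complete_bipartite (fun x => x.1)) => //.
  by move=> [[] i] [[] j].
have dn : max_degree complete_bipartite = n.
  apply/eqP; rewrite eqn_leq; apply/andP; split.
    by apply/bigmax_leqP => x _; rewrite complete_bipartite_neighbours.
  pose x0 : complete_bipartite := (true, Ordinal n_gt0).
  by rewrite -(complete_bipartite_neighbours x0); apply: (leq_bigmax x0).
exists complete_bipartite; split=> //; apply/eqP; rewrite eqn_leq.
have := @clique_number_leq _ 2 isT cf; rewrite dn => -> /=.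
apply: (@leq_trans #|edges complete_bipartite|).
  rewrite card_edges_regular_tree big_nat_recr // big_nat1 /= muln1 expn1 -{1}[n]muln1.
  rewrite -mulnDr subnKC //.
  pose e (p : 'I_n * 'I_n) : {set complete_bipartite} := [set (true, p.1); (false, p.2)].
  have e_inj : injective e.
    move=> [i j] [k l] E.
    have : (true, i) \in e (k, l) by rewrite -E set21.
    have : (false, j) \in e (k, l) by rewrite -E set22.
    by rewrite !inE /= !xpair_eqE /= orbF => /eqP-> /eqP->.
  rewrite -[n in n * _]card_ord -[n in _ * n]card_ord -card_prod -(card_imset _ e_inj).
  apply/subset_leq_card/subsetP => _ /imsetP[[i j] _ ->].
  by apply/(@edgeP complete_bipartite); exists (true, i), (false, j).
apply: clique_number_geq => A B.
have ends X : X \in edges complete_bipartite ->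
    exists i j, (true, i) \in X /\ (false, j) \in X.
  case/edgeP=> [[[] i]] [[[] j]] [//= _ ->]; first by exists i, j; rewrite set21 set22.
  by exists j, i; rewrite set21 set22.
case/ends=> i [_ [iA _]] /ends[_ [j [_ jB]]].
by exists (true, i), [:: (false, j)].
Qed.

End CompleteBipartite.

Import GRing.Theory.
Local Open Scope ring_scope.

(** * Coordinates and kernels of linear forms *)

Section Coordinates.
Variables (F : finFieldType) (n : nat).
Implicit Types (x y : 'rV[F]_n.+1) (a b : F) (i : nat).

Definition crd x i : F := x 0 (inord i).
(** Coordinates past the end of [s] are 0, so short lists denote sparse vectors. *)
Definition vec (s : seq F) : 'rV[F]_n.+1 := \row_j s`_j.

Lemma crd_vec s i : (i < n.+1)%N -> crd (vec s) i = s`_i.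
Proof. by move=> in1; rewrite /crd mxE inordK. Qed.

Lemma crd_inj x y : (forall i, (i < n.+1)%N -> crd x i = crd y i) -> x = y.
Proof.
move=> xy; apply/rowP => j; have := xy j (ltn_ord j).
by rewrite /crd inord_val.
Qed.

Lemma crdD x y i : crd (x + y) i = crd x i + crd y i.
Proof. by rewrite /crd mxE. Qed.

Lemma crdN x i : crd (- x) i = - crd x i.
Proof. by rewrite /crd mxE. Qed.

Lemma crdZ a x i : crd (a *: x) i = a * crd x i.
Proof. by rewrite /crd mxE. Qed.

Lemma crd0 i : crd 0 i = 0.
Proof. by rewrite /crd mxE. Qed.

Definition crdE := (crdD, crdN, crdZ, crd0).

Lemma crd_neq0 x : x != 0 -> exists2 i, (i < n.+1)%N & crd x i != 0.
Proof.
move=> x0; case: (pickP (fun j => x 0 j != 0)) => [j xj|x00].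
  by exists j; rewrite // /crd inord_val.
case/eqP: x0; apply/rowP => j; rewrite mxE; apply/eqP.
by have := x00 j; case: eqP.
Qed.

End Coordinates.

Local Notation "x $ i" := (crd x i) (at level 2, i at level 1, format "x $ i").

Section LinearForm.
Variables (F : finFieldType) (V : finLmodType F) (f : V -> F).
Hypothesis f_lin : forall (a b : F) x y, f (a *: x + b *: y) = a * f x + b * f y.

(** A nonzero form is onto, and its fibres are the cosets of its kernel. *)
Lemma card_kernel z : f z != 0 -> #|V| = (#|F| * #|[set x | f x == 0%R]|)%N.
Proof.
move=> fz; rewrite -cardsT.
rewrite (@card_fibers _ _ f setT #|[set x | f x == 0]|).
  suff -> : f @: setT = [set: F] by rewrite cardsT.
  apply/eqP; rewrite eqEsubset subsetT; apply/subsetP => c _.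
  apply/imsetP; exists ((c / f z) *: z) => //.
  by have := f_lin (c / f z) 0 z 0; rewrite scale0r addr0 => ->; rewrite mul0r addr0 divfK.
move=> x _; rewrite -[RHS](card_imset _ (addrI x)); apply: eq_card => y.
rewrite [LHS]inE in_setT; apply/eqP/imsetP => [fyx|[w]].
  exists (y - x); last by rewrite addrC subrK.
  rewrite inE; have := f_lin 1 (-1) y x.
  by rewrite scale1r scaleN1r mul1r mulN1r fyx subrr => ->.
rewrite inE => /eqP fw ->; have := f_lin 1 1 x w.
by rewrite !scale1r !mul1r fw addr0.
Qed.

Lemma line_meets_kernel y z : y != 0 -> z \notin point y ->
  exists r, [/\ r \in line y z, r != 0 & f r = 0].
Proof.
move=> y0 zy; have [fy|fy] := eqVneq (f y) 0; first by exists y; rewrite mem_linel.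
exists (f z *: y + (- f y) *: z); split; last by rewrite f_lin mulNr mulrC subrr.
  by apply: line_comb; [apply: mem_linel | apply: mem_liner].
apply: contraNneq zy => /eqP; rewrite scaleNr subr_eq0 => /eqP E.
by apply/pointP; exists ((f y)^-1 * f z); rewrite -scalerA E scalerK.
Qed.

End LinearForm.

Section GeometryConnection.
Variables (F : finFieldType) (V : finLmodType F) (P : {set V}) (R : rel V) (t : nat).
Local Notation adjacent := (geometry_adj P R).

Hypothesis reach : forall x L, x \in P -> L \in lines P R -> exists r p,
  [/\ r \in L, path adjacent (point x) p, last (point x) p = point r,
      point r \in points P & (size p).+1 < t]%N.

Lemma connected_of_reach A L B M : incident P R A L -> incident P R B M ->
  exists C p, [/\ C \in [set A; L], path adjacent C p,
    last C p \in [set B; M] & (size p < t)%N].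
Proof.
case/and3P=> /imsetP[x xP ->] _ _ /and3P[_ Ml _].
have [r [p [rM xp lp rP szp]]] := reach xP Ml.
have rM' : point r \subset M by case/linesP: Ml rM => u [w [_ _ _ ->]] /point_sub_line.
(* The bound in [reach] leaves room for the last step, from [r] to [M]. *)
exists (point x), (rcons p M); split.
- by rewrite set21.
- by rewrite rcons_path xp lp /geometry_adj /incident rP Ml rM'.
- by rewrite last_rcons set22.
- by rewrite size_rcons.
Qed.

End GeometryConnection.

(** * The projective plane and the symplectic quadrangle *)

Section ProjectivePlane.
Variable F : finFieldType.

Lemma projective_plane : exists G : sgraph,
  [/\ cycle_free (2 * 3 + 1) G, max_degree G = #|F|.+1 &
      clique_number (power_graph (line_graph G) 3) = #|edges (regular_tree 3 #|F|.+1)|].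
Proof.
pose P := [set~ 0 : 'rV[F]_3].
have P0 : 0 \notin P by rewrite !inE eqxx.
apply: (@geometry_extremal F _ P (fun _ _ => true)) => //.
- by move=> x y _ _ y0; rewrite !inE.
- by move=> x _; rewrite cardsT card_mx.
- by rewrite cardsC1 card_mx subn1.
move=> A L B M /and3P[/imsetP[x xP ->] _ _] /and3P[/imsetP[y yP ->] _ _].
have y0 : y != 0 by apply: P_neq0 yP.
have [|p [xp lp szp]] := @collinear_path F _ P (fun _ _ => true) P0 _ x y xP isT y0 => //.
  by move=> u w _ _ w0; rewrite !inE.
by exists (point x), p; rewrite set21 lp set21.
Qed.

End ProjectivePlane.

Section SymplecticQuadrangle.
Variable F : finFieldType.
Implicit Types x y z : 'rV[F]_4.

Definition symp x y := x$0 * y$1 - x$1 * y$0 + (x$2 * y$3 - x$3 * y$2).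

Lemma symplecticr a b x y z : symp x (a *: y + b *: z) = a * symp x y + b * symp x z.
Proof. by rewrite /symp !crdE; ring. Qed.

Lemma symp_sym x y : symp y x = - symp x y.
Proof. by rewrite /symp; ring. Qed.

Lemma symp_nondegenerate x : x != 0 -> exists y, symp x y != 0.
Proof.
case/crd_neq0 => -[|[|[|[|//]]]] _ xi.
(* The witness is the basis vector paired with the nonzero coordinate of [x]. *)
- by exists (vec 3 [:: 0; 1]); rewrite /symp !crd_vec //= !(mulr0, mulr1, subr0, addr0).
- by exists (vec 3 [:: 1]); rewrite /symp !crd_vec //= !(mulr0, mulr1, subr0, addr0, sub0r) oppr_eq0.
- by exists (vec 3 [:: 0; 0; 0; 1]); rewrite /symp !crd_vec //= !(mulr0, mulr1, subr0, oppr0, add0r).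
- by exists (vec 3 [:: 0; 0; 1]); rewrite /symp !crd_vec //= !(mulr0, mulr1, subr0, oppr0, add0r) oppr_eq0.
Qed.

Lemma symplectic_quadrangle : exists G : sgraph,
  [/\ cycle_free (2 * 4 + 1) G, max_degree G = #|F|.+1 &
      clique_number (power_graph (line_graph G) 4) = #|edges (regular_tree 4 #|F|.+1)|].
Proof.
pose P := [set~ 0 : 'rV[F]_4]; pose R x y := symp x y == 0.
have P0 : 0 \notin P by rewrite !inE eqxx.
have Rsym : symmetric R by move=> x y; rewrite /R symp_sym oppr_eq0.
have Rrefl x : x \in P -> R x x by move=> _; rewrite /R; apply/eqP; rewrite /symp; ring.
have Rlin x y z a b : R x y -> R x z -> R x (a *: y + b *: z).
  by rewrite /R symplecticr => /eqP-> /eqP->; rewrite !mulr0 addr0.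
have RP x y : x \in P -> R x y -> y != 0 -> y \in P by move=> _ _; rewrite !inE.
apply: (@geometry_extremal F _ P R) => //.
- move=> x; rewrite !inE => /symp_nondegenerate[z xz].
  have := card_kernel (fun a b => @symplecticr a b x) xz.
  rewrite card_mx (expnS _ 3) => /eqP; rewrite eqn_pmul2l => [/eqP//|].
  exact: ltnW (finNzRing_gt1 F).
- by rewrite cardsC1 card_mx subn1.
apply: connected_of_reach => x L xP Ll.
case/linesP: (Ll) => y [z [yP yz zy EL]]; have y0 : y != 0 by apply: P_neq0 yP.
(* The line meets the hyperplane orthogonal to [x], in a point collinear with [x]. *)
have [r [rL r0 xr]] := line_meets_kernel (fun a b => @symplecticr a b x) y0 zy.
have xr' : R x r by apply/eqP.
have [p [xp lp szp]] := collinear_path P0 RP xP xr' r0.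
by exists r, p; rewrite EL imset_f // (RP _ _ xP xr').
Qed.

End SymplecticQuadrangle.

(** * The split Cayley hexagon *)

Section SplitCayleyHexagon.
Variable F : finFieldType.
Local Notation V := 'rV[F]_7.
Implicit Types x y z : V.

(* A trace zero split octonion is a Zorn matrix [(a, u; v, -a)] with
   [a = x$0], [u = (x$1, x$2, x$3)] and [v = (x$4, x$5, x$6)]. The diagonal of
   the product [x * y] is [(c, omul_tr x y - c)] where [c = (omul x y)$0], and
   the other entries of [x * y] are those of [omul x y]. *)
Definition omul x y : V := vec 6
  [:: x$0 * y$0 + (x$1 * y$4 + x$2 * y$5 + x$3 * y$6);
      x$0 * y$1 - y$0 * x$1 - (x$5 * y$6 - x$6 * y$5);
      x$0 * y$2 - y$0 * x$2 - (x$6 * y$4 - x$4 * y$6);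
      x$0 * y$3 - y$0 * x$3 - (x$4 * y$5 - x$5 * y$4);
      y$0 * x$4 - x$0 * y$4 + (x$2 * y$3 - x$3 * y$2);
      y$0 * x$5 - x$0 * y$5 + (x$3 * y$1 - x$1 * y$3);
      y$0 * x$6 - x$0 * y$6 + (x$1 * y$2 - x$2 * y$1)].

Definition omul_tr x y := x$0 * y$0 *+ 2
  + (x$1 * y$4 + x$2 * y$5 + x$3 * y$6) + (x$4 * y$1 + x$5 * y$2 + x$6 * y$3).

Definition onorm x := x$0 ^+ 2 + (x$1 * x$4 + x$2 * x$5 + x$3 * x$6).

(** The two conditions together make all entries of the octonion product zero, including the lower
    right one that [omul] leaves out. *)
Definition oper x y := (omul x y == 0) && (omul_tr x y == 0).

Ltac by_coordinates := apply: crd_inj => -[|[|[|[|[|[|[|//]]]]]]] _;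
  rewrite ?crdE /omul ?crd_vec //= ?crdE ?crd_vec //= /omul_tr /onorm; ring.

Lemma omulr a b x y z : omul x (a *: y + b *: z) = a *: omul x y + b *: omul x z.
Proof. by_coordinates. Qed.

Lemma omul_trr a b x y z :
  omul_tr x (a *: y + b *: z) = a * omul_tr x y + b * omul_tr x z.
Proof. by rewrite /omul_tr !crdE; ring. Qed.

(** Conjugation negates trace zero octonions and reverses products, so [y * x] is the conjugate of
    [x * y]. *)
Lemma omulC x y : omul y x = omul_tr x y *: vec 6 [:: 1] - omul x y.
Proof. by_coordinates. Qed.

Lemma omul_trC x y : omul_tr y x = omul_tr x y.
Proof. by rewrite /omul_tr; ring. Qed.

Lemma omulxx x : omul x x = onorm x *: vec 6 [:: 1].
Proof. by_coordinates. Qed.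

Lemma omul_trxx x : omul_tr x x = onorm x *+ 2.
Proof. by rewrite /omul_tr /onorm; ring. Qed.

Lemma omul0r x : omul x 0 = 0.
Proof. by have := omulr 0 0 x 0 0; rewrite !scale0r addr0. Qed.

(* Up to terms with a factor [omul_tr x y], this is [(x * y) * y = x * (y * y)]. *)
Lemma omulA_right x y : omul (omul x y) y =
  onorm y *: x - omul_tr x y *: vec 6 [:: 0; 0; 0; 0; y$4; y$5; y$6].
Proof. by_coordinates. Qed.

(** This is [x * (x * y) = (x * x) * y]. The correction, as in [omulA_right], arises because [omul]
    reads [omul x y] as having trace zero, which changes the lower right entry by [omul_tr x y]. *)
Lemma omulA_left x y : omul x (omul x y) =
  onorm x *: y - omul_tr x y *: vec 6 [:: 0; x$1; x$2; x$3].
Proof. by_coordinates. Qed.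

Lemma omul_trA_left x y : omul_tr x (omul x y) = x$0 * omul_tr x y.
Proof. by rewrite /omul_tr /omul !crd_vec //=; ring. Qed.

Lemma omul_trA_right x y : omul_tr (omul x y) y = y$0 * omul_tr x y.
Proof. by rewrite /omul_tr /omul !crd_vec //=; ring. Qed.

Lemma operC : symmetric oper.
Proof.
suff imp x y : oper x y -> oper y x by move=> x y; apply/idP/idP; apply: imp.
case/andP=> /eqP xy /eqP txy.
by rewrite /oper (omulC x y) (omul_trC x y) xy txy scale0r subrr !eqxx.
Qed.

Lemma oper_lin x y z a b : oper x y -> oper x z -> oper x (a *: y + b *: z).
Proof.
case/andP=> /eqP xy /eqP txy /andP[/eqP xz /eqP txz].
by rewrite /oper omulr omul_trr xy txy xz txz !scaler0 !mulr0 !addr0 !eqxx.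
Qed.

Definition nilpotents : {set V} := [set x | (x != 0) && (onorm x == 0)].

Lemma nilpotentP x : reflect (x != 0 /\ onorm x = 0) (x \in nilpotents).
Proof. by rewrite inE; apply: (iffP andP) => -[x0 /eqP]. Qed.

Lemma zero_not_nilpotent : 0 \notin nilpotents.
Proof. by rewrite inE eqxx. Qed.

Lemma oper_refl x : x \in nilpotents -> oper x x.
Proof.
by case/nilpotentP=> _ nx; rewrite /oper omulxx omul_trxx nx scale0r mul0rn !eqxx.
Qed.

(** If [x * y = 0], then [0 = (x * y) * y = onorm y *: x], and [x] is not zero. *)
Lemma oper_nilpotent x y : x \in nilpotents -> oper x y -> y != 0 -> y \in nilpotents.
Proof.
case/nilpotentP=> x0 _ /andP[/eqP xy /eqP txy] y0; apply/nilpotentP; split=> //.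
have := omulA_right x y; rewrite xy txy scale0r subr0 omulC omul0r subr0.
rewrite [omul_tr _ _](_ : _ = 0); last by rewrite /omul_tr !crd0 !mulr0 mul0rn !addr0.
by rewrite scale0r => /esym/eqP; rewrite scaler_eq0 (negbTE x0) orbF => /eqP.
Qed.

(* If [x] and [y] are nilpotent and orthogonal but not collinear, then [x * y]
   is the unique point collinear with both. *)
Lemma oper_middle x y : x \in nilpotents -> y \in nilpotents -> omul_tr x y = 0 ->
  oper x (omul x y) /\ oper (omul x y) y.
Proof.
move=> /nilpotentP[_ nx] /nilpotentP[_ ny] txy.
rewrite /oper omulA_left omulA_right omul_trA_left omul_trA_right nx ny txy.
by rewrite !scale0r !mulr0 subrr !eqxx.
Qed.

(** Both maps are restrictions of octonion automorphisms: [rotate3] permutes the three indices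
    cyclically, [reflect3] swaps the diagonal entries and replaces [(u, v)] by [(-v, -u)]. They can
    bring any of the coordinates 1 to 6 to position 1, up to sign. *)
Definition rotate3 x : V := vec 6 [:: x$0; x$2; x$3; x$1; x$5; x$6; x$4].
Definition reflect3 x : V := vec 6 [:: - x$0; - x$4; - x$5; - x$6; - x$1; - x$2; - x$3].

Lemma rotate3_inj : injective rotate3.
Proof.
apply: (@can_inj _ _ _ (rotate3 \o rotate3)) => x.
by apply: crd_inj => -[|[|[|[|[|[|[|//]]]]]]] _; rewrite /= !crd_vec.
Qed.

Lemma reflect3_inj : injective reflect3.
Proof.
apply: (@can_inj _ _ _ reflect3) => x.
by apply: crd_inj => -[|[|[|[|[|[|[|//]]]]]]] _; rewrite /= !crd_vec //= ?crd_vec //= opprK.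
Qed.

Lemma rotate3_0 : rotate3 0 = 0.
Proof. by apply: crd_inj => -[|[|[|[|[|[|[|//]]]]]]] _; rewrite crd_vec //= !crd0. Qed.

Lemma reflect3_0 : reflect3 0 = 0.
Proof.
by apply: crd_inj => -[|[|[|[|[|[|[|//]]]]]]] _; rewrite crd_vec //= !crd0 oppr0.
Qed.

Lemma rotate3_oper x y : oper (rotate3 x) (rotate3 y) = oper x y.
Proof.
have trE : omul_tr (rotate3 x) (rotate3 y) = omul_tr x y.
  by rewrite /omul_tr !crd_vec //=; ring.
have mulE : omul (rotate3 x) (rotate3 y) = rotate3 (omul x y).
  by apply: crd_inj => -[|[|[|[|[|[|[|//]]]]]]] _; rewrite /omul !crd_vec //=; ring.
by rewrite /oper trE mulE -{1}rotate3_0 (inj_eq rotate3_inj).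
Qed.

Lemma reflect3_oper x y : oper (reflect3 x) (reflect3 y) = oper x y.
Proof.
have trE : omul_tr (reflect3 x) (reflect3 y) = omul_tr x y.
  by rewrite /omul_tr !crd_vec //=; ring.
rewrite /oper trE andbC [RHS]andbC; case: eqP => //= txy.
(* The image of [x * y] has the lower right entry of [x * y] in the upper left corner, hence the
   trace term. *)
have -> : omul (reflect3 x) (reflect3 y) =
    reflect3 (omul x y) + omul_tr x y *: vec 6 [:: 1].
  apply: crd_inj => -[|[|[|[|[|[|[|//]]]]]]] _;
  by rewrite crdD crdZ /omul !crd_vec //= /omul_tr; ring.
by rewrite txy scale0r addr0 -{1}reflect3_0 (inj_eq reflect3_inj).
Qed.

Lemma card_oper_transport (f : V -> V) x : injective f ->
  (forall x y, oper (f x) (f y) = oper x y) ->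
  #|[set y | oper (f x) y]| = #|[set y | oper x y]|.
Proof.
move=> f_inj fR; rewrite -(card_preimset _ f_inj); apply: eq_card => y.
by rewrite !inE fR.
Qed.

(* When [x$1 != 0], the solutions [y] of [x * y = 0] are parametrized by their
   coordinates 1, 5 and 6. *)
Lemma card_oper1 x : onorm x = 0 -> x$1 != 0 -> #|[set y | oper x y]| = (#|F| ^ 3)%N.
Proof.
move=> nx x1.
(* Coordinates 0, 2, 3 and 4 of [y] are solved from coordinates 1, 6, 5 and 0 of [x * y = 0], where
   they have coefficient [x$1] up to sign. *)
pose c (p : F * F * F) := (x$0 * p.1.1 - x$5 * p.2 + x$6 * p.1.2) / x$1.
pose f (p : F * F * F) : V := vec 6 [:: c p; p.1.1;
  (x$2 * p.1.1 - c p * x$6 + x$0 * p.2) / x$1;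
  (x$3 * p.1.1 + c p * x$5 - x$0 * p.1.2) / x$1;
  - (x$0 * c p + x$2 * p.1.2 + x$3 * p.2) / x$1; p.1.2; p.2].
have f_inj : injective f.
  move=> [[a1 a2] a3] [[b1 b2] b3] E.
  have := congr1 (fun y => y$1) E; have := congr1 (fun y => y$5) E.
  by have := congr1 (fun y => y$6) E; rewrite /f !crd_vec //= => -> -> ->.
(* Norm zero determines [x$4]; substituting it makes the remaining equations hold. *)
have x4 : x$4 = - (x$0 ^+ 2 + x$2 * x$5 + x$3 * x$6) / x$1.
  apply: (mulfI x1); rewrite [RHS]mulrC divfK //; apply/eqP.
  by rewrite -subr_eq0 -nx /onorm; apply/eqP; ring.
have -> : [set y | oper x y] = f @: setT.
  apply/eqP; rewrite eqEsubset; apply/andP; split; apply/subsetP => y; last first.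
    case/imsetP=> p _ ->; rewrite inE; apply/andP; split; apply/eqP.
      apply: crd_inj => -[|[|[|[|[|[|[|//]]]]]]] _;
      rewrite crd0 /omul crd_vec //= /f !crd_vec //= /c ?x4; field; exact: x1.
    by rewrite /omul_tr /f !crd_vec //= /c ?x4; field; exact: x1.
  rewrite inE => /andP[/eqP xy _]; apply/imsetP; exists ((y$1, y$5), y$6) => //.
  have h i : (omul x y)$i = 0 by rewrite xy crd0.
  have y0 : y$0 = c ((y$1, y$5), y$6).
    have := h 1; rewrite /omul crd_vec //= /c /= => h1.
    by apply: (mulIf x1); rewrite divfK //; apply: subr0_eq; rewrite -[RHS]oppr0 -h1; ring.
  apply: crd_inj => -[|[|[|[|[|[|[|//]]]]]]] _; rewrite /f crd_vec //= -?y0 //;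
    apply: (mulIf x1); rewrite divfK //; apply: subr0_eq.
  - by have := h 6; rewrite /omul crd_vec //= => <-; ring.
  - by have := h 5; rewrite /omul crd_vec //= => h5; rewrite -[RHS]oppr0 -h5; ring.
  - by have := h 0; rewrite /omul crd_vec //= => <-; ring.
by rewrite card_imset // cardsT !card_prod mulnn -expnSr.
Qed.

Lemma card_oper x : x \in nilpotents -> #|[set y | oper x y]| = (#|F| ^ 3)%N.
Proof.
case/nilpotentP=> x_neq0 nx.
have rotn y : onorm (rotate3 y) = onorm y.
  by rewrite /onorm !crd_vec //=; ring.
have refn y : onorm (reflect3 y) = onorm y.
  by rewrite /onorm !crd_vec //=; ring.
have rotc y := card_oper_transport y rotate3_inj rotate3_oper.
have refc y := card_oper_transport y reflect3_inj reflect3_oper.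
have [x1|x1] := eqVneq x$1 0; last exact: card_oper1.
have [x2|x2] := eqVneq x$2 0; last first.
  by rewrite -rotc card_oper1 ?rotn // crd_vec.
have [x3|x3] := eqVneq x$3 0; last first.
  by rewrite -rotc -rotc card_oper1 ?rotn // crd_vec //= crd_vec.
have [x4|x4] := eqVneq x$4 0; last first.
  by rewrite -refc card_oper1 ?refn // crd_vec //= oppr_eq0.
have [x5|x5] := eqVneq x$5 0; last first.
  by rewrite -rotc -refc card_oper1 ?refn ?rotn // crd_vec //= crd_vec //= oppr_eq0.
have [x6|x6] := eqVneq x$6 0; last first.
  rewrite -rotc -rotc -refc card_oper1 ?refn ?rotn //.
  by rewrite crd_vec //= crd_vec //= crd_vec //= oppr_eq0.
case/eqP: x_neq0; apply: crd_inj => -[|[|[|[|[|[|[|//]]]]]]] _; rewrite crd0 //.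
move: nx; rewrite /onorm x1 x2 x3 !mul0r !addr0 => /eqP.
by rewrite expf_eq0 => /eqP.
Qed.

(* In characteristic 2 the coordinates 1 to 6 of a vector of norm 0 are
   arbitrary and determine its coordinate 0, squaring being bijective. *)
Lemma card_nilpotents : 2 \in [pchar F] -> #|nilpotents| = (#|F| ^ 6 - 1)%N.
Proof.
move=> F2; have sq_inj : injective (fun a : F => a ^+ 2).
  by move=> a b /= /(fmorph_inj (pFrobenius_aut F2)).
pose form (y : 'rV[F]_6) := y$0 * y$3 + y$1 * y$4 + y$2 * y$5.
pose f (y : 'rV[F]_6) : V := vec 6
  [:: invF sq_inj (- form y); y$0; y$1; y$2; y$3; y$4; y$5].
have f_inj : injective f.
  move=> y z E; apply: crd_inj => i i6; have := congr1 (fun w => w$(i.+1)) E.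
  by rewrite !crd_vec //; case: i i6 => [|[|[|[|[|[|//]]]]]].
pose Q : {set V} := [set x | onorm x == 0].
have : #|Q| = (#|F| ^ 6)%N.
  suff -> : Q = f @: setT by rewrite card_imset // cardsT card_mx.
  apply/setP => x; rewrite inE; apply/eqP/imsetP => [nx|[y _ ->]]; last first.
    rewrite /onorm !crd_vec //= (f_invF sq_inj) /form; ring.
  exists (vec 5 [:: x$1; x$2; x$3; x$4; x$5; x$6]) => //.
  apply: crd_inj => i i7; rewrite crd_vec //.
  case: i i7 => [|[|[|[|[|[|[|//]]]]]]] _; rewrite /= ?crd_vec //=.
  apply: (sq_inj); rewrite /= (f_invF sq_inj) /form !crd_vec //=.
  by apply: subr0_eq; rewrite -nx /onorm; ring.
rewrite (cardsD1 0) inE [onorm 0](_ : _ = 0); last first.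
  by rewrite /onorm !crd0 expr0n !mul0r !addr0.
rewrite eqxx add1n => <-; rewrite subn1 /=; apply: eq_card => x.
by rewrite !inE.
Qed.

Lemma split_cayley_hexagon : 2 \in [pchar F] -> exists G : sgraph,
  [/\ cycle_free (2 * 6 + 1) G, max_degree G = #|F|.+1 &
      clique_number (power_graph (line_graph G) 6) = #|edges (regular_tree 6 #|F|.+1)|].
Proof.
move=> F2; apply: (@geometry_extremal F _ nilpotents oper) => //.
- exact: zero_not_nilpotent.
- exact: operC.
- exact: oper_refl.
- exact: oper_lin.
- exact: oper_nilpotent.
- exact: card_oper.
- exact: card_nilpotents.
apply: connected_of_reach => x L xP Ll.
case/linesP: (Ll) => y [z [yP yz zy EL]].
have y0 : y != 0 by apply: P_neq0 yP; apply: zero_not_nilpotent.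
have [r [rL r0 xr]] := line_meets_kernel (fun a b => @omul_trr a b x) y0 zy.
have rP : r \in nilpotents.
  have [LP _] := line_singular operC oper_refl oper_lin oper_nilpotent Ll.
  by apply: LP; rewrite ?EL.
have collinear := collinear_path zero_not_nilpotent oper_nilpotent.
have rp := imset_f (@point F _) rP.
(* If the product is zero, [x] and [r] are collinear. Otherwise the product is a point between them,
   and two paths of length at most 2 are joined. *)
have [s0|s0] := eqVneq (omul x r) 0.
  have [|p [xp lp szp]] := collinear x r xP _ r0; first by rewrite /oper s0 xr !eqxx.
  by exists r, p; rewrite EL; split=> //; rewrite ltnS; apply: leq_ltn_trans szp _.
have [xs sr] := oper_middle xP rP xr.
have sP := oper_nilpotent xP xs s0.
have [p [xp lp szp]] := collinear x _ xP xs s0.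
have [p' [xp' lp' szp']] := collinear _ r sP sr r0.
exists r, (p ++ p'); rewrite EL; split=> //.
- by rewrite cat_path xp lp.
- by rewrite last_cat lp.
- by rewrite size_cat !ltnS; apply: (leq_add szp szp').
Qed.

End SplitCayleyHexagon.

Local Close Scope ring_scope.

Theorem theorem10 (t : nat) (ht : 2 <= t) :
  (forall (G : sgraph) (Delta : nat),
     cycle_free (2 * t + 1) G -> max_degree G = Delta -> 1 <= Delta ->
     clique_number (power_graph (line_graph G) t)
       <= #|edges (regular_tree t Delta)|) /\
  (t \in [:: 2; 3; 4; 6] ->
   forall N : nat, exists2 Delta : nat, N < Delta &
     exists G : sgraph,
       [/\ cycle_free (2 * t + 1) G,
           max_degree G = Delta &
           clique_number (power_graph (line_graph G) t)
             = #|edges (regular_tree t Delta)|]).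
Proof.
split=> [G Delta cfG <- _|t_in N]; first exact: clique_number_leq (ltnW ht) cfG.
(* A field with [2 ^ N.+1] elements is large enough and has the characteristic required by
   [split_cayley_hexagon]. *)
have [F F2 cardF] := @PrimePowerField 2 N.+1 isT isT.
have NF : N < #|F|.+1 by rewrite cardF !ltnS ltnW // ltnW // ltn_expl.
move: t_in; rewrite !inE => /or4P[] /eqP->.
- by exists N.+1 => //; apply: complete_bipartite_extremal.
- by exists #|F|.+1 => //; apply: projective_plane.
- by exists #|F|.+1 => //; apply: symplectic_quadrangle.
- by exists #|F|.+1 => //; apply: split_cayley_hexagon.
Qed.
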